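(* Let $K$ be a field of characteristic $0$ and let $p\geq 2$ be an integer. The linearization of the polynomial $[x_1,x_2]^{p-1}$ generates an irreducible $S_{2p-2}$-submodule of $\Gamma_{2p-2}(\mathfrak{N}_p)$ that corresponds to the partition $(p-1,p-1)$.
   Context: $K\langle X\rangle$ is the free unital associative $K$-algebra on $X=\{x_1,x_2,\dots\}$ and $K\langle X_n\rangle$ the free unital subalgebra generated by $x_1,\dots,x_n$. Commutators are left-normed: $[u_1,u_2]=u_1u_2-u_2u_1$, $[u_1,\dots,u_{m+1}]=[[u_1,\dots,u_m],u_{m+1}]$. $I_{p+1}$ is the two-sided ideal of $K\langle X\rangle$ generated by all commutators $[u_1,\dots,u_{p+1}]$, $u_i\in K\langle X\rangle$. $\mathfrak{N}_p$ is the variety of unital associative $K$-algebras satisfying $[x_1,\dots,x_{p+1}]=0$, and $F_n(\mathfrak{N}_p)=K\langle X_n\rangle/(I_{p+1}\cap K\langle X_n\rangle)$. $\Gamma_n\subset K\langle X_n\rangle$ is the space of multilinear polynomials of degree $n$ in $x_1,\dots,x_n$ that are proper, i.e. linear combinations of products of commutators (of length at least $2$) whose entries are variables. $\Gamma_n(\mathfrak{N}_p)$ is the image of $\Gamma_n$ in $F_n(\mathfrak{N}_p)$, and $S_n$ acts on it by permuting variables. The (complete) linearization of a multihomogeneous polynomial $f$ of degree $d_i$ in $x_i$ and total degree $n$ is the multilinear polynomial in $n$ variables obtained by substituting for each $x_i$ a sum of $d_i$ new variables (distinct for distinct $i$), taking the component that is multilinear in all new variables, and naming the new variables $x_1,\dots,x_n$.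 Its image in $\Gamma_n(\mathfrak{N}_p)$ is meant. *)

(* Defs.v *)
From HB Require Import structures.
From mathcomp Require Import all_boot all_order all_algebra all_fingroup.
From mathcomp Require Import mxrepresentation generic_quotient ring_quotient.
From mathcomp Require Import finmap boolp.
From mathcomp Require Import monalg.

Set Implicit Arguments.
Unset Strict Implicit.
Unset Printing Implicit Defensive.

Import GRing.Theory.

Local Open Scope ring_scope.
Local Open Scope quotient_scope.

(* Subspaces, ideals and submodules below are Prop-valued predicates. *)

Definition lspan (K : fieldType) (V : lmodType K) (S : V -> Prop) (v : V) :
    Prop :=
  exists s : seq (K * V),
    (forall t, t \in s -> S t.2) /\ v = \sum_(t <- s) t.1 *: t.2.

Definition ideal_gen (A : nzRingType) (S : A -> Prop) (x : A) : Prop :=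
  exists s : seq (A * A * A),
    (forall t, t \in s -> S t.1.2) /\
    x = \sum_(t <- s) t.1.1 * t.1.2 * t.2.

(* Left-normed commutator: lcomm u [:: v1; ...; vk] = [u, v1, ..., vk], of
   length k + 1. *)
Definition comm (A : nzRingType) (u v : A) : A := u * v - v * u.
Definition lcomm (A : nzRingType) (u : A) (us : seq A) : A :=
  foldl (@comm A) u us.

(* The free unital associative K-algebra on the alphabet I: the monoid algebra
   of the free monoid of words over I. Variables are indexed from 0. *)
Notation fralg K I := {malg K[{fmonom I}]}.

Section FreeAlgebra.
Variable K : fieldType.

Definition fvar (I : choiceType) (i : I) : fralg K I := << fmu i >>.

(* The unital algebra homomorphism sending the variable i to v i. *)
Definition fsubst (I : choiceType) (A : lalgType K) (v : I -> A)
    (f : fralg K I) : A :=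
  mmap (in_alg A) (fun m : {fmonom I} => \prod_(i <- m) v i) f.

Definition perm_vars (n : nat) (s : 'S_n) (f : fralg K 'I_n) : fralg K 'I_n :=
  fsubst (fun i => fvar (s i)) f.

(* The inclusion of K<X_n> in K<X>. *)
Definition fembed (n : nat) (f : fralg K 'I_n) : fralg K nat :=
  fsubst (fun i : 'I_n => fvar (i : nat)) f.

Definition multilin_word (n : nat) (m : {fmonom 'I_n}) : bool :=
  perm_eq m (enum 'I_n).

Definition multilinear (n : nat) (f : fralg K 'I_n) : Prop :=
  forall m, m \in msupp f -> multilin_word m.

Definition multilin_part (n : nat) (f : fralg K 'I_n) : fralg K 'I_n :=
  \sum_(m <- msupp f | multilin_word m) << f@_m *g m >>.

(* Complete linearization. The naming of the new variables is given by c: the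
   new variables substituted for the i-th old one are those of index j with
   c j = i. Thus c must have as many elements in the fibre over i as the degree
   of f in the i-th variable. *)
Definition linearization (m n : nat) (c : 'I_n -> 'I_m) (f : fralg K 'I_m) :
    fralg K 'I_n :=
  multilin_part (fsubst (fun i => \sum_(j | c j == i) fvar j) f).

Definition proper (n : nat) : fralg K 'I_n -> Prop :=
  lspan (fun f => exists cs : seq ('I_n * seq 'I_n),
    (forall t, t \in cs -> t.2 != [::]) /\
    f = \prod_(t <- cs) lcomm (fvar t.1) [seq fvar i | i <- t.2]).

Definition Gamma (n : nat) (f : fralg K 'I_n) : Prop :=
  multilinear f /\ proper f.

(* commI k is the ideal generated by the commutators of length k, i.e. I_k. *)
Definition commI (k : nat) : fralg K nat -> Prop :=
  ideal_gen (fun x => exists u us, (size us).+1 = k /\ x = lcomm u us).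

(* I_{p+1} as an ideal of K<X_n>. *)
Definition relI (p n : nat) : {pred fralg K 'I_n} :=
  [pred f | `[< commI p.+1 (fembed f) >]].
Arguments relI : clear implicits.

Lemma fsubstZ (I : choiceType) (A : lalgType K) (v : I -> A) (a : K) f :
  fsubst v (a *: f) = a *: fsubst v f.
Proof.
rewrite /fsubst (mmapEw (msuppZ_le _ _)) mmapE scaler_sumr.
by apply: eq_bigr => m _; rewrite mcoeffZ !mulr_algl scalerA.
Qed.

Lemma fsubstD (I : choiceType) (A : lalgType K) (v : I -> A) f g :
  fsubst v (f + g) = fsubst v f + fsubst v g.
Proof. exact: mmapD. Qed.

Lemma fsubst0 (I : choiceType) (A : lalgType K) (v : I -> A) :
  fsubst v 0 = 0.
Proof. exact: mmap0. Qed.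

Lemma relI_submod_closed p n : submod_closed (relI p n).
Proof.
split; first by apply/asboolP; exists [::]; rewrite big_nil /fembed fsubst0.
move=> a f g /asboolP [s [hs es]] /asboolP [t [ht et]]; apply/asboolP.
exists ([seq (a *: u.1.1, u.1.2, u.2) | u <- s] ++ t); split.
  move=> u; rewrite mem_cat => /orP [/mapP [w ws ->]|]; last exact: ht.
  exact: (hs w ws).
rewrite big_cat big_map /= -et /fembed fsubstD fsubstZ -/(fembed f) es.
congr (_ + _); rewrite scaler_sumr; apply: eq_bigr => u _.
by rewrite !scalerAl.
Qed.

Lemma malgMZr (M : monomType) (a : K) (f g : {malg K[M]}) :
  f * (a *: g) = a *: (f * g).
Proof.
rewrite (malgMEw (fsubset_refl _) (msuppZ_le a g)) malgME scaler_sumr.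
apply: eq_bigr => k _; rewrite scaler_sumr; apply: eq_bigr => l _.
by apply/malgP => m; rewrite !mcoeffsE mulrnAr mulrCA.
Qed.

Section Hom.
Variables (I J : choiceType) (v : I -> fralg K J).

Definition word_eval (m : {fmonom I}) : fralg K J := \prod_(i <- m) v i.

Fact word_eval_mm : mmorphism word_eval.
Proof.
by split=> [x y|]; rewrite /word_eval ?fmM ?big_cat // fm1 big_nil.
Qed.

HB.instance Definition _ :=
  isMultiplicative.Build {fmonom I} (fralg K J) word_eval word_eval_mm.

Lemma fsubstM f g : fsubst v (f * g) = fsubst v f * fsubst v g.
Proof.
rewrite /fsubst -/word_eval.
have [h _] := @commr_mmap_is_multiplicative {fmonom I} K (fralg K J)
  (in_alg (fralg K J)) word_eval
  (fun g m m' => etrans (mulr_algl _ _)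
    (esym (etrans (malgMZr _ _ _) (congr1 _ (mulr1 _))))).
exact: h.
Qed.

Lemma fsubst_var i : fsubst v (fvar i) = v i.
Proof. by rewrite /fsubst mmapU /= fmU big_seq1 scale1r mul1r. Qed.

Lemma fsubst1 : fsubst v 1 = 1.
Proof.
exact: (@mmap1 {fmonom I} K (fralg K J) (in_alg (fralg K J)) word_eval).
Qed.

Lemma fsubst_sum (T : Type) (s : seq T) P F :
  fsubst v (\sum_(t <- s | P t) F t) = \sum_(t <- s | P t) fsubst v (F t).
Proof. exact: (big_morph _ (fsubstD v) (fsubst0 v)). Qed.

Lemma fsubst_lcomm u us :
  fsubst v (lcomm u us) = lcomm (fsubst v u) (map (fsubst v) us).
Proof.
elim: us u => //= w us IH u; rewrite IH /comm.
by rewrite fsubstD -scaleN1r fsubstZ scaleN1r !fsubstM.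
Qed.
End Hom.

Lemma fsubst_comp (I J L : choiceType) (v : I -> fralg K J)
    (w : J -> fralg K L) (f : fralg K I) :
  fsubst w (fsubst v f) = fsubst (fun i => fsubst w (v i)) f.
Proof.
rewrite {2}/fsubst mmapE fsubst_sum [RHS]/fsubst mmapE.
apply: eq_bigr => m _; rewrite fsubstM fsubstZ fsubst1; congr (_ * _).
exact: (big_morph _ (fsubstM w) (fsubst1 w)).
Qed.

Lemma eq_fsubst (I J : choiceType) (v w : I -> fralg K J) (f : fralg K I) :
  v =1 w -> fsubst v f = fsubst w f.
Proof.
move=> e; rewrite /fsubst !mmapE; apply: eq_bigr => m _; congr (_ * _).
by apply: eq_bigr.
Qed.

Lemma relI_perm p n (s : 'S_n) (f : fralg K 'I_n) :
  f \in relI p n -> perm_vars s f \in relI p n.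
Proof.
move=> /asboolP [t [ht et]]; apply/asboolP.
pose sg (i : nat) : nat := if insub i is Some j then s j else i.
pose w (i : nat) : fralg K nat := fvar (sg i).
have -> : fembed (perm_vars s f) = fsubst w (fembed f).
  rewrite /fembed /perm_vars !fsubst_comp; apply: eq_fsubst => i.
  by rewrite !fsubst_var /w /sg valK.
rewrite et fsubst_sum.
exists [seq (fsubst w x.1.1, fsubst w x.1.2, fsubst w x.2) | x <- t]; split;
  last by rewrite big_map; apply: eq_bigr => x _; rewrite !fsubstM.
move=> x /mapP [y yt ->] /=; have [u [us [sz ->]]] := ht y yt.
by exists (fsubst w u), (map (fsubst w) us); rewrite size_map fsubst_lcomm.
Qed.

End FreeAlgebra.

Arguments relI : clear implicits.

(* The quotient of a K-vector space by a subspace; the library only provides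
   its additive group. *)
Section LmodQuotient.
Variables (K : fieldType) (V : lmodType K) (S : {pred V}).
Variable clS : submod_closed S.

HB.instance Definition _ := GRing.isSubmodClosed.Build K V S clS.

Definition lquot : Type := Quotient.quot S.

HB.instance Definition _ := GRing.Zmodule.on lquot.
HB.instance Definition _ := EqQuotient.on lquot.

Definition lquot_scale (a : K) : lquot -> lquot := lift_op1 lquot ( *:%R a).

Lemma lquot_piP (x y : V) :
  reflect (\pi_lquot x = \pi_lquot y) (x - y \in S).
Proof. by rewrite Quotient.idealrBE; apply: eqP. Qed.

Lemma lquot_piD (x y : V) : \pi_lquot (x + y) = \pi_lquot x + \pi_lquot y.
Proof. exact: Quotient.pi_add. Qed.

Lemma lquot_piZ (a : K) (x : V) :
  \pi_lquot (a *: x) = lquot_scale a (\pi_lquot x).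
Proof.
rewrite /lquot_scale; unlock; apply/lquot_piP.
by rewrite -scalerBr rpredZ //; apply/lquot_piP; rewrite reprK.
Qed.

Fact lquot_scaleA a b v :
  lquot_scale a (lquot_scale b v) = lquot_scale (a * b) v.
Proof. by rewrite -[v]reprK -!lquot_piZ scalerA. Qed.

Fact lquot_scale1 : left_id 1 lquot_scale.
Proof. by move=> v; rewrite -[v]reprK -lquot_piZ scale1r. Qed.

Fact lquot_scaleDr : right_distributive lquot_scale +%R.
Proof.
move=> a u v; rewrite -[u]reprK -[v]reprK.
by rewrite -lquot_piD -!lquot_piZ scalerDr lquot_piD.
Qed.

Fact lquot_scaleDl v : {morph lquot_scale^~ v : a b / a + b}.
Proof.
by move=> a b /=; rewrite -[v]reprK -!lquot_piZ scalerDl lquot_piD.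
Qed.

HB.instance Definition _ := GRing.Zmodule_isLmodule.Build K lquot
  lquot_scaleA lquot_scale1 lquot_scaleDr lquot_scaleDl.

End LmodQuotient.

Section RelativelyFree.
Variables (K : fieldType) (p n : nat).

(* F_n(N_p) = K<X_n> / (I_{p+1} \cap K<X_n>). Only its structure of K-vector
   space with an action of S_n is needed, so its product is not defined. *)
Definition relfree : lmodType K := lquot (relI_submod_closed K p n).

Definition to_relfree (f : fralg K 'I_n) : relfree :=
  \pi_(lquot (relI_submod_closed K p n)) f.

Definition relfree_perm (s : 'S_n) (x : relfree) : relfree :=
  to_relfree (perm_vars s (repr (x : lquot (relI_submod_closed K p n)))).

(* The action of S_n does not depend on the choice of representatives. *)
Lemma relfree_permE (s : 'S_n) (f : fralg K 'I_n) :
  relfree_perm s (to_relfree f) = to_relfree (perm_vars s f).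
Proof.
apply/lquot_piP.
have -> g h : perm_vars s g - perm_vars s h = perm_vars s (g - h).
  by rewrite /perm_vars fsubstD -[- h]scaleN1r fsubstZ scaleN1r.
apply: relI_perm; apply/(lquot_piP (relI_submod_closed K p n)).
exact: (reprK (to_relfree f : lquot (relI_submod_closed K p n))).
Qed.

Definition relGamma (x : relfree) : Prop :=
  exists2 f, Gamma f & x = to_relfree f.

Definition Sn_span (x : relfree) : relfree -> Prop :=
  lspan (fun y => exists s, y = relfree_perm s x).

End RelativelyFree.

(* The subspace U, stable under act, affords the matrix representation rG.
   Since (s * t) i = t (s i) in 'S_n, the action of S_n on polynomials is a
   right action, as is that of matrices on row vectors. *)
Definition affords (K : fieldType) (n : nat) (V : lmodType K)
    (act : 'S_n -> V -> V) (U : V -> Prop)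
    (d : nat) (rG : mx_representation K [set: 'S_n] d) : Prop :=
  exists b : 'I_d -> V,
    [/\ forall x, U x <-> exists a : 'I_d -> K, x = \sum_i a i *: b i,
        forall a : 'I_d -> K, \sum_i a i *: b i = 0 -> forall i, a i = 0
      & forall s i, act s (b i) = \sum_j rG s i j *: b j].

(* The irreducible S_n-module of a partition la of n (a nonincreasing sequence
   of sum n), over a field of characteristic 0: the ideal of the group algebra
   generated by the Young symmetrizer of the tableau of shape la whose rows,
   read one after the other, are 0, ..., n-1. The entry k of this tableau is in
   row reshape_index la k and column reshape_offset la k. It is a right ideal
   for the product of 'S_n, hence a left ideal for the composition of maps. *)
Section Specht.
Variables (K : fieldType) (n : nat) (la : seq nat).

Definition row_stab : {set 'S_n} :=
  [set s : 'S_n |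
    [forall k : 'I_n, reshape_index la (s k) == reshape_index la k]].

Definition col_stab : {set 'S_n} :=
  [set s : 'S_n |
    [forall k : 'I_n, reshape_offset la (s k) == reshape_offset la k]].

Definition young_symmetrizer : 'rV[K]_(gcard [set: 'S_n]%G) :=
  \sum_(r in row_stab) \sum_(q in col_stab)
    (-1) ^+ odd_perm q *: delta_mx 0 (gring_index [set: 'S_n]%G (r * q)%g).

Definition specht_repr :=
  submod_repr (cyclic_mx_module (regular_repr K [set: 'S_n]%G)
                                young_symmetrizer).

End Specht.

(* Main.v *)
From HB Require Import structures.
Require Import Defs.
From mathcomp Require Import all_boot all_order all_algebra all_fingroup.
From mathcomp Require Import mxrepresentation.
From mathcomp Require Import ssrAC zify finmap monalg.

(* In the group algebra of S_n, n = 2m, the linearization L of [x_1, x_2]^m,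
   m = p - 1, is antisymmetric in the positions 2j, 2j + 1 for each j < m and
   symmetric in the variables substituted for each of x_1, x_2. Up to left and
   right translation it is therefore fixed by the signed column sum Q on the
   left and by the row sum P on the right, so it is a multiple of Q P by von
   Neumann's lemma (Q g P is a multiple of Q P for every g). Left
   multiplication by Q maps the Specht module P Q K[S_n], which is simple, onto
   Q P K[S_n], so the image of the latter in any quotient is either zero or
   isomorphic to the Specht module.

   It remains to see that L is not in the T-ideal. Identifying variables sends
   L to a positive multiple of [x_1, x_2]^m, and the m-fold tensor power of the
   Grassmann algebra on two generators a, b satisfies [u_0, ..., u_(m+1)] = 0:
   every commutator with a new element turns at least one more tensor factor
   into the central element ab. For x and y the sums of the a's and of the b's,
   [x, y]^m is 2^m m! times the product of all the a's and b's. *)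

Set Implicit Arguments.
Unset Strict Implicit.
Unset Printing Implicit Defensive.

Import GRing.Theory.
Local Open Scope ring_scope.

(** * The Specht module of a two-row rectangle *)

Section GroupRing.
Variables (K : fieldType) (gT : finGroupType) (G : {group gT}).
Local Notation aG := (regular_repr K G).
Local Notation R_G := (group_ring K G).

Lemma gring_rowG x : x \in G -> gring_row (aG x) = delta_mx 0 (gring_index G x).
Proof. by move=> Gx; rewrite /gring_row rowK gring_indexK // mul1g. Qed.

Lemma gring_mx_row_mul X Y : (X \in R_G)%MS -> (Y \in R_G)%MS ->
  gring_mx aG (gring_row X *m Y) = X *m Y.
Proof.
move=> RX RY; rewrite -gring_row_mul gring_rowK //.
by rewrite envelop_mxM.
Qed.

Lemma group_ring_regular (X : 'M[K]_(gcard G)) :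
  #|G|%:R != 0 :> K -> (X \in R_G)%MS ->
  exists2 A, (A \in R_G)%MS & X *m A *m X = X.
Proof.
(* The average of B over the left translations by G is still a pseudo-inverse of
   X; it commutes with them, so it is the right multiplication by some A. *)
move=> nzG RX; pose B := pinvmx X.
pose A Y := #|G|%:R^-1 *: \sum_(g in G)
  aG g^-1%g *m gring_mx aG (gring_row (aG g *m Y) *m B).
exists (A 1%:M).
  rewrite linearZ scalemx_sub //= linear_sum summx_sub //= => g Gg.
  by rewrite envelop_mxM ?envelop_mx_id ?groupV ?gring_mxP.
have XA : X *m A 1%:M = A X.
  have /envelop_mxP [x ->] := RX.
  rewrite /A -scalemxAr mulmx_suml; congr (_ *: _).
  have -> : \sum_(g in G) aG g^-1%g *m
      gring_mx aG (gring_row (aG g *m (\sum_(h in G) x h *: aG h)) *m B) =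
    \sum_(h in G) \sum_(g in G) x h *: (aG g^-1%g *m
      gring_mx aG (gring_row (aG g *m aG h) *m B)).
    rewrite exchange_big; apply: eq_bigr => g Gg.
    rewrite mulmx_sumr linear_sum mulmx_suml linear_sum mulmx_sumr.
    apply: eq_bigr => h Gh.
    by rewrite -scalemxAr linearZ -scalemxAl linearZ -scalemxAr.
  apply: eq_bigr => h Gh; rewrite -scaler_sumr -scalemxAl; congr (_ *: _).
  rewrite mulmx_sumr (reindex_inj (mulIg h)) /=.
  rewrite (eq_bigl (mem G)) => [|g]; last by rewrite groupMr.
  apply: eq_bigr => g Gg; rewrite mulmx1 mulmxA.
  by rewrite -!repr_mxM ?groupV ?groupM // invMg mulgA mulgV mul1g.
rewrite XA /A -scalemxAl mulmx_suml.
(* Every summand, multiplied by [X], gives [X], since [X *m B *m X = X]; dividing the sum by the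
   group order leaves [X]. *)
rewrite (eq_bigr (fun=> X)) => [|g Gg].
  by rewrite sumr_const -scaler_nat scalerA mulVf // scale1r.
rewrite -mulmxA -[X in gring_mx _ _ *m X](gring_rowK RX) -gring_mxA.
rewrite gring_rowK // -mulmxA.
rewrite -gring_row_mul -mulmxA (mulmxA X) mulmxKpV //.
rewrite gring_rowK ?envelop_mxM ?envelop_mx_id //.
by rewrite mulmxA -repr_mxM ?groupV // mulVg repr_mx1 mul1mx.
Qed.
End GroupRing.

(** * Row and column permutations of the tableau with two rows of length [m] *)

Section TwoRows.
Variables (n m : nat) (nE : n = (m + m)%N).

(** The two boxes of column [j]. The casts are there because [n] will be [2 * p - 2], which equals
    [m + m] only up to a proof. *)
Definition top (j : 'I_m) : 'I_n := cast_ord (esym nE) (lshift m j).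
Definition bot (j : 'I_m) : 'I_n := cast_ord (esym nE) (rshift m j).
Definition upper (i : 'I_n) : bool := (i < m)%N.

Lemma upper_top j : upper (top j).
Proof. by rewrite /upper /= ltn_ord. Qed.

Lemma upper_bot j : upper (bot j) = false.
Proof. by rewrite /upper /= ltnNge leq_addr. Qed.

Lemma top_inj : injective top.
Proof. by move=> i j /cast_ord_inj /lshift_inj. Qed.

Lemma bot_inj : injective bot.
Proof. by move=> i j /cast_ord_inj /rshift_inj. Qed.

Lemma top_bot_neq i j : (top i == bot j) = false.
Proof. by apply/negP => /eqP e; have := upper_top i; rewrite e upper_bot. Qed.

Lemma ord_top_bot i : (exists j, i = top j) \/ (exists j, i = bot j).
Proof.
rewrite -[i](cast_ordK nE); case: (splitP (cast_ord nE i)) => j ej.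
  by left; exists j; congr cast_ord; apply: val_inj.
by right; exists j; congr cast_ord; apply: val_inj.
Qed.

Lemma row_indexE (k : 'I_n) : reshape_index [:: m; m] k = ~~ upper k.
Proof.
have h2 : (k < m + m)%N by rewrite -nE.
rewrite /upper /reshape_index /=.
case: (ltnP k m) => hk; first by rewrite subn_eq0 hk.
have -> : (k.+1 - m == 0)%N = false by rewrite subn_eq0 ltnNge hk.
by rewrite -subnDA subn_eq0 h2.
Qed.

Lemma row_stabP (s : 'S_n) :
  reflect (forall k, upper (s k) = upper k) (s \in row_stab n [:: m; m]).
Proof.
rewrite inE; apply: (iffP forallP) => H k; move: (H k); rewrite !row_indexE.
  by move/eqP; case: (upper _); case: (upper _).
by move=> ->.
Qed.

Lemma col_indexE (k : 'I_n) :
  reshape_offset [:: m; m] k = (if upper k then k : nat else k - m)%N.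
Proof.
rewrite /reshape_offset row_indexE; case: (upper k) => /=; first by rewrite subn0.
by rewrite addn0.
Qed.

Lemma col_index_top j : reshape_offset [:: m; m] (top j) = j.
Proof. by rewrite col_indexE upper_top. Qed.

Lemma col_index_bot j : reshape_offset [:: m; m] (bot j) = j.
Proof. by rewrite col_indexE upper_bot /= addKn. Qed.

Lemma col_stabP (s : 'S_n) :
  reflect (forall k, reshape_offset [:: m; m] (s k) = reshape_offset [:: m; m] k)
    (s \in col_stab n [:: m; m]).
Proof. by rewrite inE; apply: (iffP forallP) => H k; apply/eqP/H. Qed.

Definition col_swap (j : 'I_m) : 'S_n := tperm (top j) (bot j).

Lemma odd_col_swap j : odd_perm (col_swap j).
Proof. by rewrite odd_tperm top_bot_neq. Qed.

Lemma col_swap_stab j : col_swap j \in col_stab n [:: m; m].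
Proof.
apply/col_stabP => k; rewrite /col_swap.
by case: tpermP => [->|->|//]; rewrite col_index_bot col_index_top.
Qed.

Lemma row_stab_group : group_set (row_stab n [:: m; m]).
Proof.
apply/group_setP; split=> [|s t /row_stabP hs /row_stabP ht].
  by apply/row_stabP => k; rewrite perm1.
by apply/row_stabP => k; rewrite permM ht hs.
Qed.

Lemma col_stab_group : group_set (col_stab n [:: m; m]).
Proof.
apply/group_setP; split=> [|s t /col_stabP hs /col_stabP ht].
  by apply/col_stabP => k; rewrite perm1.
by apply/col_stabP => k; rewrite permM ht hs.
Qed.

(** Induction on the number of columns that [q] interchanges: composing with the swap of such a
    column lowers it, and a column permutation that interchanges no column is the identity. *)
Lemma col_stab_ind (P : 'S_n -> Prop) :
  P 1%g -> (forall q j, P q -> P (col_swap j * q)%g) ->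
  forall q, q \in col_stab n [:: m; m] -> P q.
Proof.
move=> P1 PM q; have [k] := ubnP #|[set j | q (top j) == bot j]|.
elim: k q => // k IH q leqk /col_stabP Cq.
case: (set_0Vmem [set j | q (top j) == bot j]) => [e0|[j]].
  suff -> : q = 1%g by [].
  have qtop i : q (top i) = top i.
    have := Cq (top i); have [[l e]|[l e]] := ord_top_bot (q (top i)); rewrite e;
    rewrite ?col_index_top ?col_index_bot => /val_inj eli; first by rewrite eli.
    have : i \in [set j | q (top j) == bot j] by rewrite inE e eli.
    by rewrite e0 inE.
  apply/permP => i; rewrite perm1; have [[l ->]|[l ->]] := ord_top_bot i => //.
  have := Cq (bot l); have [[l' e]|[l' e]] := ord_top_bot (q (bot l)); rewrite e;
  rewrite ?col_index_top ?col_index_bot => /val_inj el; last by rewrite el.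
  move: e; rewrite el -{1}(qtop l) => /perm_inj /eqP.
  by rewrite eq_sym top_bot_neq.
rewrite inE => qj; rewrite -[q](mulKg (col_swap j)) tpermV; apply: PM.
apply: IH; last first.
  by apply/col_stabP => i; rewrite permM Cq; apply/col_stabP/col_swap_stab.
rewrite -ltnS; apply: leq_trans leqk; rewrite ltnS.
apply: proper_card; apply/properP; split.
  apply/subsetP => i; rewrite !inE permM; case: (eqVneq i j) => [->//|ij].
  by rewrite tpermD // ?top_bot_neq ?(inj_eq top_inj) // eq_sym ?top_bot_neq //
    eq_sym.
exists j; rewrite !inE ?qj //= permM tpermL.
by apply/eqP => e; move/eqP: qj; rewrite -e => /perm_inj /eqP; rewrite top_bot_neq.
Qed.

(** * The row and column symmetrizers and the simplicity of the Specht module *)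

Section Symmetrizers.
Variable K : fieldType.

(* This is the sign of q if s = q * r with q a column and r a row permutation,
   and 0 if s is not of this form. *)
Definition coldet (s : 'S_n) : K :=
  \prod_(j < m) ((upper (s (top j)))%:R - (upper (s (bot j)))%:R).

Lemma coldet1 : coldet 1%g = 1.
Proof.
by apply: big1 => j _; rewrite !perm1 upper_top upper_bot subr0.
Qed.

Lemma coldet_swap j s : coldet (col_swap j * s)%g = - coldet s.
Proof.
rewrite /coldet (bigD1 j) //= [in RHS](bigD1 j) //= -mulNr opprB.
rewrite !permM tpermL tpermR; congr (_ * _); apply: eq_bigr => i ij.
by rewrite !permM !tpermD // ?top_bot_neq ?(inj_eq top_inj) ?(inj_eq bot_inj)
  // eq_sym ?top_bot_neq.
Qed.

Lemma coldet_row s r : r \in row_stab n [:: m; m] ->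
  coldet (s * r)%g = coldet s.
Proof.
by move=> /row_stabP Rr; apply: eq_bigr => j _; rewrite !permM !Rr.
Qed.

(* von Neumann's combinatorial lemma for the tableau with rows 0..m-1 and
   m..2m-1: if no column of it is sent by s into a single row, then s is a
   product of column swaps and of a row permutation; otherwise both sides
   vanish. *)
Lemma col_row_ext (V : lmodType K) (H : 'S_n -> V) :
  2%:R != 0 :> K ->
  (forall j s, H (col_swap j * s)%g = - H s) ->
  (forall s r, r \in row_stab n [:: m; m] -> H (s * r)%g = H s) ->
  forall s, H s = coldet s *: H 1%g.
Proof.
move=> char2 Hcol Hrow s.
have [k] := ubnP #|[set j | ~~ upper (s (top j))]|.
elim: k s => // k IH s leqk.
have [j /eqP ej|Hne] := pickP (fun j => upper (s (top j)) == upper (s (bot j))).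
  have -> : coldet s = 0 by rewrite /coldet (bigD1 j) //= ej subrr mul0r.
  rewrite scale0r.
  (* Both boxes of column [j] go to the same row, so the swap, moved to the right of [s], becomes a
     row permutation and [H s = - H s]. *)
  have es : (col_swap j * s = s * tperm (s (top j)) (s (bot j)))%g.
    by rewrite -tpermJ conjgE mulgA mulgV mul1g.
  have := Hcol j s; rewrite es Hrow; last first.
    by apply/row_stabP => i; case: tpermP => // ->; rewrite ej.
  move/eqP; rewrite -addr_eq0 -mulr2n -scaler_nat scaler_eq0 (negPf char2).
  by move/eqP.
(* If every top box stays in the upper row, then every bottom box goes to the lower one, and [s] is
   a row permutation. *)
case: (set_0Vmem [set j | ~~ upper (s (top j))]) => [e0|[j]].
  have up j : upper (s (top j)).
    by have := in_set0 j; rewrite -e0 inE => /negbFE.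
  have Rs : s \in row_stab n [:: m; m].
    apply/row_stabP => i; have [[j ->]|[j ->]] := ord_top_bot i; first by rewrite up upper_top.
    by have := Hne j; rewrite up upper_bot; case: (upper _).
  by rewrite -[s]mul1g Hrow // coldet_row // coldet1 scale1r.
(* Otherwise swapping column [j] brings its top box back to the upper row and changes the sign of
   both sides. *)
rewrite inE => sj; rewrite -[s](mulKg (col_swap j)) tpermV.
rewrite Hcol coldet_swap scaleNr IH //.
rewrite -ltnS; apply: leq_trans leqk; rewrite ltnS.
apply: proper_card; apply/properP; split.
  apply/subsetP => i; rewrite !inE permM; case: (eqVneq i j) => [->//|ij].
  by rewrite tpermD // ?(inj_eq top_inj) // eq_sym ?top_bot_neq.
exists j; rewrite !inE ?sj //= permM tpermL negbK.
by have := Hne j; rewrite (negPf sj); case: (upper _).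
Qed.

Local Notation G := [set: 'S_n]%G.
Local Notation aG := (regular_repr K G).
Local Notation R_G := (group_ring K G).

(** Elements of the group algebra are taken as matrices of the regular representation, so that their
    products are matrix products in the same order. *)
Definition row_sum : 'M[K]_(gcard G) := \sum_(r in row_stab n [:: m; m]) aG r.
Definition col_sum : 'M[K]_(gcard G) :=
  \sum_(q in col_stab n [:: m; m]) (-1) ^+ odd_perm q *: aG q.
Local Notation P := row_sum.
Local Notation Q := col_sum.

Lemma regular_mxM s t : aG (s * t)%g = aG s *m aG t.
Proof. by rewrite repr_mxM ?inE. Qed.

Lemma mem_regular_mx s : (aG s \in R_G)%MS.
Proof. by rewrite envelop_mx_id ?inE. Qed.

Lemma mem_row_sum : (P \in R_G)%MS.
Proof. by rewrite linear_sum summx_sub // => r _; apply: mem_regular_mx. Qed.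

Lemma mem_col_sum : (Q \in R_G)%MS.
Proof.
by rewrite linear_sum summx_sub // => r _; rewrite linearZ scalemx_sub ?mem_regular_mx.
Qed.

Lemma row_sum_mull r : r \in row_stab n [:: m; m] -> aG r *m P = P.
Proof.
move=> Rr; rewrite mulmx_sumr [RHS](reindex_inj (mulgI r)) /=.
apply: eq_big => [s|s _]; last by rewrite regular_mxM.
by rewrite (@groupMl _ (Group row_stab_group)).
Qed.

Lemma row_sum_mulr r : r \in row_stab n [:: m; m] -> P *m aG r = P.
Proof.
move=> Rr; rewrite mulmx_suml [RHS](reindex_inj (mulIg r)) /=.
apply: eq_big => [s|s _]; last by rewrite regular_mxM.
by rewrite (@groupMr _ (Group row_stab_group)).
Qed.

Lemma col_sum_mull j : aG (col_swap j) *m Q = - Q.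
Proof.
rewrite /col_sum mulmx_sumr [in RHS](reindex_inj (mulgI (col_swap j))) /= -sumrN.
apply: eq_big => [s|s _].
  by rewrite (@groupMl _ (Group col_stab_group)) ?col_swap_stab.
by rewrite -scalemxAr regular_mxM odd_permM odd_col_swap addTb signrN scaleNr opprK.
Qed.

Lemma col_sum_mulr j : Q *m aG (col_swap j) = - Q.
Proof.
rewrite /col_sum mulmx_suml [in RHS](reindex_inj (mulIg (col_swap j))) /= -sumrN.
apply: eq_big => [s|s _].
  by rewrite (@groupMr _ (Group col_stab_group)) ?col_swap_stab.
by rewrite -scalemxAl regular_mxM odd_permM odd_col_swap addbT signrN scaleNr opprK.
Qed.

Hypothesis char0 : [pchar K] =i pred0.

Lemma natr_neq0 k : (0 < k)%N -> k%:R != 0 :> K.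
Proof. by rewrite (GRing.pcharf0P K).1 -?lt0n. Qed.


(** The function [s -> Q s P] changes sign under column swaps on the left and is invariant under row
    permutations on the right, so [col_row_ext] applies. *)
Lemma col_mid_row s : Q *m aG s *m P = coldet s *: (Q *m P).
Proof.
have -> := @col_row_ext _ (fun s => Q *m aG s *m P) (@natr_neq0 2 isT).
- by rewrite repr_mx1 mulmx1.
- by move=> j t; rewrite regular_mxM mulmxA col_sum_mulr !mulNmx.
- by move=> t r Rr; rewrite regular_mxM -!mulmxA row_sum_mull.
Qed.

(** Inversion exchanges the two sides, so [col_row_ext] applies to [s -> P s^-1 Q]. *)
Lemma row_mid_col s : P *m aG s *m Q = coldet s^-1%g *: (P *m Q).
Proof.
rewrite -{1}[s]invgK.
have -> := @col_row_ext _ (fun s => P *m aG s^-1%g *m Q) (@natr_neq0 2 isT).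
- by rewrite invg1 repr_mx1 mulmx1.
- by move=> j t; rewrite invMg tpermV regular_mxM -!mulmxA (col_sum_mull j) !mulmxN.
- move=> t r Rr; rewrite invMg regular_mxM mulmxA row_sum_mulr //.
  by rewrite -[r^-1%g]/(_ : 'S_n) (@groupV _ (Group row_stab_group)).
Qed.

Lemma col_mid_row_scale X : (X \in R_G)%MS ->
  exists a, Q *m X *m P = a *: (Q *m P).
Proof.
move=> /envelop_mxP [x ->]; exists (\sum_(s in G) x s * coldet s).
rewrite [Q *m _]mulmx_sumr mulmx_suml scaler_suml; apply: eq_bigr => s _.
by rewrite -scalemxAr -scalemxAl col_mid_row scalerA.
Qed.

Lemma row_mid_col_scale X : (X \in R_G)%MS ->
  exists a, P *m X *m Q = a *: (P *m Q).
Proof.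
move=> /envelop_mxP [x ->]; exists (\sum_(s in G) x s * coldet s^-1%g).
rewrite [P *m _]mulmx_sumr mulmx_suml scaler_suml; apply: eq_bigr => s _.
by rewrite -scalemxAr -scalemxAl row_mid_col scalerA.
Qed.

Lemma symmetric_ring_regular X : (X \in R_G)%MS -> exists2 A, (A \in R_G)%MS & X *m A *m X = X.
Proof. by apply: group_ring_regular; apply/natr_neq0/cardG_gt0. Qed.

(** Regularity gives [B] with [QP B QP = QP], and the middle part [P B Q] is a multiple of [PQ]. *)
Lemma col_row_quasi_idem : exists a, Q *m P = a *: (Q *m P *m (Q *m P)).
Proof.
have RQP : (Q *m P \in R_G)%MS by rewrite envelop_mxM ?mem_col_sum ?mem_row_sum.
have [B RB eB] := symmetric_ring_regular RQP.
have [a ea] := row_mid_col_scale RB; exists a.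
rewrite -{1}eB -!mulmxA (mulmxA B) (mulmxA P) (mulmxA P) ea.
by rewrite -!scalemxAl -!scalemxAr !mulmxA.
Qed.

(** Regularity of [PQA] gives [Z] with [PQA Z PQA = PQA], and [PQAZPQ = a PQ] by von Neumann's
    lemma. Here [a] is nonzero because [PQA] is, so [B] is [ZPQ] divided by [a]. This is the
    simplicity of the right ideal of [PQ]. *)
Lemma row_col_generated A : (A \in R_G)%MS -> P *m Q *m A != 0 ->
  exists2 B, (B \in R_G)%MS & P *m Q *m A *m B = P *m Q.
Proof.
move=> RA nz; have [RP RQ] := (mem_row_sum, mem_col_sum).
have [Z RZ eZ] : exists2 Z, (Z \in R_G)%MS &
    P *m Q *m A *m Z *m (P *m Q *m A) = P *m Q *m A.
  by apply: symmetric_ring_regular; rewrite !envelop_mxM.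
have [a ea] : exists a, P *m (Q *m A *m Z *m P) *m Q = a *: (P *m Q).
  by apply: row_mid_col_scale; rewrite !envelop_mxM.
have nza : a != 0.
  apply: contraNneq nz => a0; rewrite -eZ.
  have -> : P *m Q *m A *m Z *m (P *m Q *m A) =
    (P *m (Q *m A *m Z *m P) *m Q) *m A by rewrite !mulmxA.
  by rewrite ea a0 scale0r mul0mx.
exists (a^-1 *: (Z *m P *m Q)).
  by rewrite linearZ scalemx_sub //= !envelop_mxM.
by rewrite -scalemxAr !mulmxA -!(mulmxA P) !mulmxA in ea *;
  rewrite ea scalerA mulVf // scale1r.
Qed.

Lemma young_symmetrizerE :
  young_symmetrizer K n [:: m; m] = gring_row (P *m Q).
Proof.
rewrite /young_symmetrizer mulmx_suml linear_sum; apply: eq_bigr => r _.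
rewrite mulmx_sumr linear_sum; apply: eq_bigr => q _.
by rewrite -scalemxAr -regular_mxM linearZ /= gring_rowG ?inE.
Qed.

(** A nonzero submodule contains some nonzero [PQA], and [row_col_generated] leads from it back to
    [PQ]. The hypothesis is supplied later by [row_col_neq0]. *)
Lemma cyclic_young_simple : P *m Q != 0 ->
  mxsimple aG (cyclic_mx aG (young_symmetrizer K n [:: m; m])).
Proof.
move=> nz; have RPQ : (P *m Q \in R_G)%MS.
  by rewrite envelop_mxM ?mem_row_sum ?mem_col_sum.
rewrite young_symmetrizerE; split; first exact: cyclic_mx_module.
  rewrite cyclic_mx_eq0; apply: contraNneq nz => e0.
  by rewrite -(gring_rowK RPQ) e0 linear0.
move=> U modU sU nzU; apply: cyclic_mx_sub => //.
have : (nz_row U <= cyclic_mx aG (gring_row (P *m Q)))%MS.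
  exact: submx_trans (nz_row_sub U) sU.
case/cyclic_mxP => A RA eA.
have [|B RB eB] := row_col_generated RA.
  apply: contraNneq nzU => e0; rewrite -nz_row_eq0 eA -gring_row_mul e0.
  by rewrite linear0.
rewrite -eB !gring_row_mul -gring_row_mul -eA.
by rewrite (mxmodule_envelop modU RB) ?nz_row_sub.
Qed.

Lemma coldet_col q s : q \in col_stab n [:: m; m] ->
  coldet (q * s)%g = (-1) ^+ odd_perm q * coldet s.
Proof.
move=> Cq; move: q Cq s; apply: col_stab_ind => [|q j IH] s.
  by rewrite mul1g odd_perm1 mul1r.
by rewrite -mulgA coldet_swap IH odd_permM odd_col_swap addTb signrN mulNr.
Qed.

(** The sum [L] satisfies [QL = |C| L] and [LP = |R| L], where [C] and [R] are the column and row
    groups. Hence [|R| |C| L = QLP], which is a multiple of [QP]. *)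
Lemma sum_coldet : exists a,
  \sum_(s in G) coldet s *: aG s = a *: (Q *m P).
Proof.
set L := \sum_(s in G) _.
pose C := Group col_stab_group; pose R := Group row_stab_group.
have QL : Q *m L = #|C|%:R *: L.
  rewrite mulmx_suml (eq_bigr (fun=> L)) => [|q Cq].
    by rewrite sumr_const scaler_nat.
  rewrite -scalemxAl {1}/L mulmx_sumr scaler_sumr [RHS](reindex_inj (mulgI q)) /=.
  apply: eq_big => [s|s _]; first by rewrite !inE.
  by rewrite -scalemxAr -regular_mxM scalerA coldet_col.
have LP : L *m P = #|R|%:R *: L.
  rewrite mulmx_sumr (eq_bigr (fun=> L)) => [|r Rr].
    by rewrite sumr_const scaler_nat.
  rewrite {1}/L mulmx_suml [RHS](reindex_inj (mulIg r)) /=.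
  apply: eq_big => [s|s _]; first by rewrite !inE.
  by rewrite -scalemxAl -regular_mxM coldet_row.
have [|a ea] := @col_mid_row_scale L.
  by apply/envelop_mxP; exists coldet.
exists ((#|R|%:R * #|C|%:R)^-1 * a); rewrite -scalerA -ea QL -scalemxAl LP.
by rewrite !scalerA -mulrA [X in _ * X]mulrC mulVf ?scale1r // mulf_neq0 ?natr_neq0
  ?cardG_gt0.
Qed.

(** * Images of the right ideal of [QP] under an equivariant map *)

Section Affords.
Variables (V : lmodType K) (act : 'S_n -> V -> V).
Variables (phi : {linear 'rV[K]_(gcard G) -> V}) (a b : 'S_n).
Hypothesis phiJ : forall x s, phi (x *m aG s) = act s (phi x).
Variable l : 'rV[K]_(gcard G).
Hypothesis lE : l = gring_row (aG a *m Q *m P *m aG b).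
Hypothesis nz : phi l != 0.

(** By [col_row_quasi_idem], [QP] is a multiple of [Q(PQ)P]; if [PQ] were 0, then [l] would be 0
    too. *)
Lemma row_col_neq0 : P *m Q != 0.
Proof.
apply: contraNneq nz => e0; have [c ec] := col_row_quasi_idem.
rewrite lE -(mulmxA (aG a)) ec.
have -> : Q *m P *m (Q *m P) = Q *m (P *m Q) *m P by rewrite !mulmxA.
by rewrite e0 mulmx0 mul0mx scaler0 mulmx0 mul0mx !linear0.
Qed.

Lemma phi_mul0 x X : (X \in R_G)%MS -> phi x = 0 -> phi (x *m X) = 0.
Proof.
move=> /envelop_mxP [z ->] x0; rewrite mulmx_sumr linear_sum big1 // => s _.
by rewrite -scalemxAr linearZ /= phiJ x0 -(linear0 phi) -phiJ mul0mx linear0 scaler0.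
Qed.

(** The map [psi], left multiplication by [aQ] followed by [phi], is equivariant. It sends the
    Specht module [PQ K[S_n]] bijectively to the module generated by [phi l]: onto since [QP] is a
    multiple of [QPQP], injective since the source is simple and [phi l] is nonzero. *)
Lemma two_row_affords :
  affords act (fun w => exists2 A, (A \in R_G)%MS & w = phi (l *m A))
    (specht_repr K n [:: m; m]).
Proof.
have [RP RQ] := (mem_row_sum, mem_col_sum).
have phiZ c X : c *: phi (gring_row X) = phi (gring_row (c *: X)).
  by rewrite !linearZ.
pose y := gring_row (aG a *m Q).
pose psi x := phi (y *m gring_mx aG x).
have psi_sum I (r : seq I) (c : I -> K) (x : I -> 'rV_(gcard G)) :
    \sum_(i <- r) c i *: psi (x i) = psi (\sum_(i <- r) c i *: x i).
  rewrite /psi linear_sum mulmx_sumr linear_sum; apply: eq_bigr => i _.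
  by rewrite linearZ -scalemxAr linearZ.
have psiJ x s : psi (x *m aG s) = act s (psi x).
  by rewrite /psi gring_mxJ ?inE // mulmxA phiJ.
pose U := cyclic_mx aG (young_symmetrizer K n [:: m; m]).
have memU x : (x <= U)%MS ->
    exists2 A, (A \in R_G)%MS & x = gring_row (P *m Q) *m A.
  by rewrite /U young_symmetrizerE => /cyclic_mxP.
have psiE A : (A \in R_G)%MS -> psi (gring_row (P *m Q) *m A) =
    phi (gring_row (aG a *m Q *m P *m Q *m A)).
  move=> RA; rewrite /psi gring_mx_row_mul ?envelop_mxM // /y.
  by rewrite -gring_row_mul !mulmxA.
have sumE (c : 'I_(\rank U) -> K) :
    \sum_i c i *: psi (row i (val_submod (1%:M : 'M_(\rank U)))) =
    psi (val_submod (\row_i c i)).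
  rewrite psi_sum [in RHS]val_submodE mulmx_sum_row; congr psi.
  by apply: eq_bigr => i _; rewrite mxE.
have gring_rowZ c (X : 'M[K]_(gcard G)) : gring_row (c *: X) = c *: gring_row X.
  by rewrite linearZ.
(* The basis is the image under [psi] of the basis of [U] in which [specht_repr] is written, so the
   matrices agree. *)
exists (fun i => psi (row i (val_submod (1%:M : 'M_(\rank U))))); split.
- move=> w; split.
    case=> A RA ->.
    have [c ec] := col_row_quasi_idem.
    (* With [QP = c QPQP], the vector [c PQPbA] of the Specht module is a preimage of
       [phi (l A)]. *)
    have sX : (c *: gring_row (P *m Q *m (P *m aG b *m A)) <= U)%MS.
      rewrite scalemx_sub // /U young_symmetrizerE; apply/cyclic_mxP.
      by exists (P *m aG b *m A); rewrite ?gring_row_mul // !envelop_mxM ?mem_regular_mx.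
    exists (fun i => in_submod U (c *: gring_row (P *m Q *m (P *m aG b *m A))) 0 i).
    rewrite sumE; have -> : \row_i in_submod U (c *: gring_row
        (P *m Q *m (P *m aG b *m A))) 0 i = in_submod U
        (c *: gring_row (P *m Q *m (P *m aG b *m A))).
      by apply/rowP => i; rewrite mxE.
    rewrite in_submodK // lE -gring_row_mul.
    have -> : psi (c *: gring_row (P *m Q *m (P *m aG b *m A))) =
      c *: psi (gring_row (P *m Q *m (P *m aG b *m A))).
      have := psi_sum _ [:: tt] (fun=> c) (fun=> gring_row (P *m Q *m (P *m aG b *m A))).
      by rewrite !big_seq1.
    rewrite [in RHS]gring_row_mul psiE ?envelop_mxM ?mem_regular_mx // phiZ.
    congr (phi (gring_row _)).
    by rewrite -[in LHS](mulmxA (aG a) Q) [in LHS]ec -!scalemxAr -!scalemxAl !mulmxA.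
  case=> c ->; rewrite sumE.
  have [A RA ->] := memU _ (val_submodP (\row_i c i)); rewrite psiE //.
  (* As [l = aQPb], this factor turns [l] into [aQPQA]. *)
  exists (aG b^-1%g *m Q *m A); first by rewrite !envelop_mxM ?mem_regular_mx.
  rewrite lE -gring_row_mul; congr (phi (gring_row _)).
  by rewrite !mulmxA -(mulmxA _ (aG b)) -regular_mxM mulgV repr_mx1 mulmx1.
- move=> c; rewrite sumE => psi0.
  suff : \row_i c i = 0 by move=> /rowP e i; have := e i; rewrite !mxE.
  apply/eqP; rewrite -(val_submod_eq0 (U := U)); apply/negPn/negP => nzc.
  have [A RA eA] := memU _ (val_submodP (\row_i c i)).
  have [|B RB eB] := row_col_generated RA.
    apply: contraNneq nzc => e0.
    by rewrite eA -gring_row_mul e0 linear0.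
  (* A nonzero element [PQA] in the kernel would bring the generator [PQ] into it, by [PQAB = PQ];
     but [l] is a multiple of [aQPQ] times [Pb], so [phi l] would vanish. *)
  have psi_gen0 : psi (gring_row (P *m Q) *m 1%:M) = 0.
    rewrite mulmx1 -eB gring_row_mul [gring_row (_ *m A)]gring_row_mul -eA.
    by rewrite /psi -{1}(gring_rowK RB) gring_mxA mulmxA gring_rowK // phi_mul0.
  case/negP: nz; have [d ed] := col_row_quasi_idem.
  have -> : l = d *: (gring_row (aG a *m Q *m P *m Q *m 1%:M) *m (P *m aG b)).
    rewrite lE -gring_row_mul -gring_rowZ; congr gring_row.
    by rewrite -[in LHS](mulmxA (aG a) Q) [in LHS]ed mulmx1 -!scalemxAr -!scalemxAl !mulmxA.
  rewrite linearZ /= phi_mul0 ?scaler0 // ?envelop_mxM ?mem_regular_mx //.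
  by rewrite -psiE ?envelop_mx1.
- move=> s i; rewrite -psiJ sumE; congr psi.
  rewrite -row_mul -(val_submodJ (cyclic_mx_module aG _)) ?inE //.
  rewrite mul1mx val_submodE row_mul [in RHS]val_submodE; congr (_ *m _).
Qed.
End Affords.

End Symmetrizers.
End TwoRows.

(** * Lie nilpotent algebras with a large power of a commutator *)

Section Grassmann2.
Variables (K : fieldType) (B : algType K).

(* The tensor product of B and of the Grassmann algebra on a, b; the four
   components are the coordinates on 1, a, b, ab. *)
Definition grass2 : Type := (B * B * B * B)%type.
HB.instance Definition _ := GRing.Lmodule.copy grass2 (B * B * B * B)%type.

Implicit Types x y z : grass2.
Local Notation "x .0" := x.1.1.1 (at level 2, format "x .0").
Local Notation "x .a" := x.1.1.2 (at level 2, format "x .a").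
Local Notation "x .b" := x.1.2 (at level 2, format "x .b").
Local Notation "x .ab" := x.2 (at level 2, format "x .ab").

(** The product for [a^2 = b^2 = 0] and [ba = -ab], with [a] and [b] commuting with [B]. *)
Definition g2mul x y : grass2 :=
  (x.0 * y.0, x.0 * y.a + x.a * y.0, x.0 * y.b + x.b * y.0,
   x.0 * y.ab + x.ab * y.0 + x.a * y.b - x.b * y.a).
Definition g2one : grass2 := (1, 0, 0, 0).

Lemma g2eqP x y :
  x.0 = y.0 -> x.a = y.a -> x.b = y.b -> x.ab = y.ab -> x = y.
Proof. by case: x y => [[[? ?] ?] ?] [[[? ?] ?] ?] /= -> -> -> ->. Qed.

Fact g2mulA : associative g2mul.
Proof.
move=> x y z; apply: g2eqP => /=.
- exact: mulrA.
- by rewrite !(mulrDl, mulrDr) !mulrA addrA.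
- by rewrite !(mulrDl, mulrDr) !mulrA addrA.
- rewrite !(mulrBl, mulrBr, mulrDl, mulrDr) !mulrA !opprD !addrA.
  by rewrite [LHS](ACl (1*2*5*7*9*3*6*4*8))%AC.
Qed.

Fact g2mul1 : left_id g2one g2mul.
Proof.
by move=> x; apply: g2eqP; rewrite /= ?mul1r ?mul0r ?addr0 ?subr0.
Qed.

Fact g2mulr1 : right_id g2one g2mul.
Proof.
by move=> x; apply: g2eqP; rewrite /= ?mulr1 ?mulr0 ?add0r ?addr0 ?subr0.
Qed.

Fact g2mulDl : left_distributive g2mul +%R.
Proof.
move=> x y z; apply: g2eqP; rewrite /= ?mulrDl ?opprD //.
- by rewrite addrACA.
- by rewrite addrACA.
- by rewrite !addrA [LHS](ACl (1*3*5*7*2*4*6*8))%AC.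
Qed.

Fact g2mulDr : right_distributive g2mul +%R.
Proof.
move=> x y z; apply: g2eqP; rewrite /= ?mulrDr ?opprD //.
- by rewrite addrACA.
- by rewrite addrACA.
- by rewrite !addrA [LHS](ACl (1*3*5*7*2*4*6*8))%AC.
Qed.

Fact g2one_neq0 : g2one != 0.
Proof. by apply/eqP => -[/eqP]; rewrite oner_eq0. Qed.

HB.instance Definition _ := GRing.Zmodule_isNzRing.Build grass2
  g2mulA g2mul1 g2mulr1 g2mulDl g2mulDr g2one_neq0.

Fact g2scaleAl (c : K) x y : c *: g2mul x y = g2mul (c *: x) y.
Proof.
by apply: g2eqP; rewrite /= ?(scalerBr, scalerDr) -!scalerAl.
Qed.

HB.instance Definition _ := GRing.Lmodule_isLalgebra.Build K grass2 g2scaleAl.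

Fact g2scaleAr (c : K) x y : c *: g2mul x y = g2mul x (c *: y).
Proof.
by apply: g2eqP; rewrite /= ?(scalerBr, scalerDr) -!scalerAr.
Qed.

HB.instance Definition _ := GRing.Lalgebra_isAlgebra.Build K grass2 g2scaleAr.
End Grassmann2.

(** A descending chain of two-sided ideals from the whole algebra to 0 in which a bracket with any
    element leads one step further down. *)
Definition lie_filtration (K : fieldType) (B : algType K) (k : nat)
    (F : nat -> B -> Prop) : Prop :=
  [/\ (forall x, F 0%N x) /\ (forall x, F k.+1 x -> x = 0),
      forall j x, F j.+1 x -> F j x,
      forall j x y, F j x -> F j y -> F j (x - y),
      forall j x y, F j x -> F j (x * y) /\ F j (y * x)
    & forall j x y, F j x -> F j.+1 (comm x y)].

(** Each of the [k + 1] brackets leads one step down. The induction runs over an arbitrary starting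
    level [j]. *)
Lemma lie_filtration_lcomm (K : fieldType) (B : algType K) k F u (us : seq B) :
  @lie_filtration K B k F -> size us = k.+1 -> lcomm u us = 0.
Proof.
case=> -[F0 Fk] _ _ _ FC sz; apply: Fk; rewrite -sz -[size us]addn0.
elim: us {sz} u 0%N (F0 u) => [|v us IH] u j Fu //=.
by rewrite addSnnS; apply: IH; apply: FC.
Qed.

(** The component on [ab] is allowed to lag one step behind: in a bracket it receives products such
    as [x.a * y.b], which are not brackets in [B] and so stay at level [j]. The other components of
    a bracket are sums of brackets in [B]. *)
Lemma lie_filtration_grass2 (K : fieldType) (B : algType K) k
    (F : nat -> B -> Prop) :
  @lie_filtration K B k F ->
  @lie_filtration K (grass2 B) k.+1 (fun j (x : grass2 B) =>
    [/\ F j x.1.1.1, F j x.1.1.2, F j x.1.2 & F j.-1 x.2]).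
Proof.
case=> -[F0 Fk] FS FB FM FC.
have FZ j : F j 0 by elim: j => // j IH; have := FC _ _ 0 IH; rewrite /comm mulr0 subr0.
have FN j x : F j x -> F j (- x) by move=> Fx; rewrite -sub0r; apply: FB.
have FD j x y : F j x -> F j y -> F j (x + y).
  by move=> Fx Fy; rewrite -[y]opprK; apply: FB => //; apply: FN.
have FP j x : F j x -> F j.-1 x by case: j => // j /FS.
have FMl j x y : F j x -> F j (x * y) by move=> /(FM _ _ y) [].
have FMr j x y : F j x -> F j (y * x) by move=> /(FM _ _ y) [].
split.
- split=> [x|x [/FS/Fk e0 /FS/Fk ea /FS/Fk eb /Fk eab]]; first by split; apply: F0.
  exact: g2eqP.
- by move=> j x [? ? ? hab]; split; [apply: FS|apply: FS|apply: FS|apply: FP].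
- by move=> j x y [? ? ? ?] [? ? ? ?]; split; apply: FB.
- move=> j x y [h0 ha hb hab]; split; split=> /=; auto 8.
- move=> j x y [h0 ha hb hab]; split=> /=.
  + exact: FC.
  + have -> : x.1.1.1 * y.1.1.2 + x.1.1.2 * y.1.1.1 -
      (y.1.1.1 * x.1.1.2 + y.1.1.2 * x.1.1.1) =
      comm x.1.1.1 y.1.1.2 + comm x.1.1.2 y.1.1.1.
      by rewrite /comm opprD !addrA [LHS](ACl (1*4*2*3))%AC.
    by apply: FD; apply: FC.
  + have -> : x.1.1.1 * y.1.2 + x.1.2 * y.1.1.1 -
      (y.1.1.1 * x.1.2 + y.1.2 * x.1.1.1) =
      comm x.1.1.1 y.1.2 + comm x.1.2 y.1.1.1.
      by rewrite /comm opprD !addrA [LHS](ACl (1*4*2*3))%AC.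
    by apply: FD; apply: FC.
  (* The component [x.2] is only at level [j.-1], and its bracket with [y.1.1.1] reaches level [j];
     at [j = 0] every element qualifies. *)
  + have Fab : F j (x.2 * y.1.1.1 - y.1.1.1 * x.2).
      by case: j hab {h0 ha hb} => // j; apply: FC.
    set X := _ - _.
    have -> : X = (x.2 * y.1.1.1 - y.1.1.1 * x.2) +
      (x.1.1.1 * y.2 - y.2 * x.1.1.1 +
       x.1.1.2 * y.1.2 - x.1.2 * y.1.1.2 - y.1.1.2 * x.1.2 + y.1.2 * x.1.1.2).
      rewrite /X !opprD !opprK !addrA.
      by rewrite [LHS](ACl (2*5*1*6*3*4*7*8))%AC.
    by do ![apply: (FD) => //| apply: (FN) => //]; auto.
Qed.

(** Write [g], [h] for the two Grassmann generators. Then [[a + g, b + h] = [a, b] + 2gh], and [gh]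
    is central of square 0, so only two terms of the binomial expansion survive. *)
Lemma grass2_comm_exp (K : fieldType) (B : algType K) (a b : B) k :
  comm ((a, 1, 0, 0) : grass2 B) ((b, 0, 1, 0) : grass2 B) ^+ k =
  (comm a b ^+ k, 0, 0, comm a b ^+ k.-1 *+ (2 * k)) :> grass2 B.
Proof.
have e : comm ((a, 1, 0, 0) : grass2 B) ((b, 0, 1, 0) : grass2 B) =
    (comm a b, 0, 0, 2%:R) :> grass2 B.
  apply: g2eqP => /=; rewrite ?(mulr0, mul0r, mulr1, mul1r, addr0, add0r, subr0) ?subrr //.
  by rewrite opprK.
rewrite e; elim: k => [|k IH]; first by rewrite !expr0 muln0 mulr0n.
rewrite exprS IH; apply: g2eqP => /=; rewrite ?(mulr0, mul0r, addr0) ?subr0 //.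
  by rewrite exprS.
case: k {IH} => [|k]; first by rewrite muln0 mulr0n mulr0 add0r expr0 mulr1.
by rewrite /= mulrnAr -exprS mulr_natl -mulrnDr addnC -mulnS.
Qed.

(** Induction on [k], from the field itself, by adjoining one pair of Grassmann generators at each
    step. *)
Lemma exists_lie_nilpotent (K : fieldType) (char0 : [pchar K] =i pred0) k :
  exists (B : algType K) (F : nat -> B -> Prop) (a b : B),
    @lie_filtration K B k F /\ comm a b ^+ k != 0.
Proof.
elim: k => [|k [B [F [a [b [hF hab]]]]]].
  exists K^o, (fun j (x : K^o) => if j is 0 then True else x = 0), 0, 0.
  rewrite expr0 oner_neq0; split=> //; split=> //.
  - by case.
  - by case=> // j x y -> ->; rewrite subr0.
  - by case=> // j x y ->; rewrite mul0r mulr0.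
  - by move=> j x y _; rewrite /comm mulrC subrr.
exists (grass2 B), (fun j (x : grass2 B) =>
    [/\ F j x.1.1.1, F j x.1.1.2, F j x.1.2 & F j.-1 x.2]).
exists (a, 1, 0, 0), (b, 0, 1, 0); split; first exact: lie_filtration_grass2.
(* The last component is [2(k + 1) [a, b]^k], nonzero in characteristic 0. *)
rewrite grass2_comm_exp; apply: contraNneq hab => -[_ /eqP].
by rewrite /= -scaler_nat scaler_eq0 ((GRing.pcharf0P K).1 char0) muln_eq0.
Qed.

(** * Words and the linearization *)

Section Evaluation.
Variables (K : fieldType) (B : algType K).

Section OneAlphabet.
Variables (I : choiceType) (z : I -> B).

Definition word_value (w : {fmonom I}) : B := \prod_(i <- w) z i.

Fact word_value_mm : mmorphism word_value.
Proof.
by split=> [x y|]; rewrite /word_value ?fmM ?big_cat // fm1 big_nil.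
Qed.

HB.instance Definition _ :=
  isMultiplicative.Build {fmonom I} B word_value word_value_mm.

Lemma evalM f g : fsubst z (f * g) = fsubst z f * fsubst z g.
Proof.
rewrite /fsubst -/word_value.
have [h _] := @commr_mmap_is_multiplicative {fmonom I} K B
  (in_alg B) word_value (fun g m m' => etrans (mulr_algl _ _) (esym (mulr_algr _ _))).
exact: h.
Qed.

Lemma eval_word (w : {fmonom I}) : fsubst z << w >> = \prod_(i <- w) z i.
Proof. by rewrite /fsubst mmapU /= scale1r mul1r. Qed.

Lemma eval_var i : fsubst z (fvar K i) = z i.
Proof. by rewrite eval_word fmU big_seq1. Qed.

Lemma eval1 : fsubst z 1 = 1.
Proof. by rewrite -mpolyC1E eval_word fm1 big_nil. Qed.

Lemma eval_sum (T : Type) (s : seq T) P F :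
  fsubst z (\sum_(t <- s | P t) F t) = \sum_(t <- s | P t) fsubst z (F t).
Proof. exact: (big_morph _ (fsubstD z) (fsubst0 z)). Qed.

Lemma eval_comm f g : fsubst z (comm f g) = comm (fsubst z f) (fsubst z g).
Proof.
rewrite /comm fsubstD -[- (g * f)]scaleN1r fsubstZ scaleN1r.
by congr (_ - _); apply: evalM.
Qed.

Lemma eval_lcomm f fs :
  fsubst z (lcomm f fs) = lcomm (fsubst z f) (map (fsubst z) fs).
Proof. by elim: fs f => //= g fs IH f; rewrite IH eval_comm. Qed.

Lemma eval_exp f k : fsubst z (f ^+ k) = fsubst z f ^+ k.
Proof. by elim: k => [|k IH]; rewrite ?expr0 ?eval1 // !exprS evalM IH. Qed.
End OneAlphabet.

Lemma eval_fembed n (z : nat -> B) (f : fralg K 'I_n) :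
  fsubst z (fembed f) = fsubst (fun i : 'I_n => z i) f.
Proof.
rewrite /fembed [fsubst _ f]/fsubst mmapE eval_sum [RHS]/fsubst mmapE.
apply: eq_bigr => w _; rewrite evalM fsubstZ eval1; congr (_ * _).
rewrite (big_morph _ (evalM z) (eval1 z)); apply: eq_bigr => i _.
exact: eval_var.
Qed.

(** Evaluation sends each generator of the ideal to a commutator of length [p + 1] in [B]. The
    assignment [z] covers all variables because the ideal lives in the free algebra on infinitely
    many. *)
Lemma eval_relI p n (z : nat -> B) (f : fralg K 'I_n) :
  (forall (u : B) us, size us = p -> lcomm u us = 0) ->
  f \in relI K p n -> fsubst (fun i : 'I_n => z i) f = 0.
Proof.
move=> nilB /boolp.asboolP [s [hs]]; rewrite -eval_fembed => ->.
rewrite eval_sum big1_seq // => t /andP [_ /hs [u [us [[sz] ->]]]].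
by rewrite !evalM eval_lcomm nilB ?size_map // mulr0 mul0r.
Qed.
End Evaluation.

(** * Coefficients of words in products *)

Section Words.
Variables (K : fieldType) (I : choiceType).

Lemma mcoeff_varM (i : I) (g : fralg K I) s :
  (fvar K i * g)@_(FMonom s) =
  if s is j :: t then (j == i)%:R * g@_(FMonom t) else 0.
Proof.
rewrite {1}/fvar malgME msuppU1 big_seq_fset1 raddf_sum /=.
have E k : << (<< fmu i >> : fralg K I)@_(fmu i) * g@_k *g mmul (fmu i) k >>@_(FMonom s)
   = g@_k *+ ((i :: k) == s :> seq I).
  rewrite mcoeffU mcoeffUU mul1r -val_eqE /= fmM fmU //.
rewrite (eq_bigr _ (fun k _ => E k)).
case: s {E} => [|j t]; first by rewrite big1.
rewrite mulr_natl [in RHS](monalgE g) raddf_sum /= -sumrMnl; apply: eq_bigr => k _.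
by rewrite mcoeffU eqseq_cons eq_sym -mulrnA mulnb andbC -val_eqE.
Qed.

Lemma malg_expand (T : finType) (h : T -> {fmonom I}) (g : fralg K I) :
  injective h -> (forall w, g@_w != 0 -> exists t, w = h t) ->
  g = \sum_t g@_(h t) *: << h t >>.
Proof.
move=> h_inj hg; apply/malgP => w; rewrite raddf_sum /=.
have E t : (g@_(h t) *: << h t >>)@_w = g@_(h t) * (h t == w)%:R.
  by rewrite mcoeffZ mcoeffU1.
rewrite (eq_bigr _ (fun t _ => E t)).
have [g0|/hg [t ->]] := eqVneq g@_w 0.
  rewrite g0 big1 // => t _.
  by case: eqP => [->|_]; rewrite ?g0 ?mul0r ?mulr0.
rewrite (bigD1 t) //= eqxx mulr1 big1 ?addr0 // => t' t't.
by rewrite (inj_eq h_inj) (negPf t't) mulr0.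
Qed.
End Words.

Lemma commMl (A : nzRingType) (u v g : A) :
  comm u v * g = u * (v * g) - v * (u * g).
Proof. by rewrite /comm mulrBl !mulrA. Qed.

(** Stated for any [u], [v] whose left multiplication strips the first letter with a weight; this
    covers both variables and sums of variables. *)
Lemma mcoeff_commM (K : fieldType) (I : choiceType) (u v g : fralg K I)
    (a b : I -> K) s :
  (forall h t, (u * h)@_(FMonom t) =
    if t is x :: t' then a x * h@_(FMonom t') else 0) ->
  (forall h t, (v * h)@_(FMonom t) =
    if t is x :: t' then b x * h@_(FMonom t') else 0) ->
  (comm u v * g)@_(FMonom s) =
  if s is [:: x, y & s'] then (a x * b y - b x * a y) * g@_(FMonom s') else 0.
Proof.
move=> hu hv; rewrite commMl mcoeffB.
apply: etrans (congr2 (fun x y : K => x - y) (hu _ _) (hv _ _)) _.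
case: s => [|x s]; first exact: subrr.
apply: etrans (congr2 (fun y z : K => a x * y - b x * z) (hv _ _) (hu _ _)) _.
by case: s => [|y s]; rewrite ?mulr0 ?subrr // !mulrA -mulrBl.
Qed.

(** * The coefficients of a power of a commutator of two sums of variables *)

Section ColumnSign.
Variable K : fieldType.

(* The coefficient of the word s in [x_0, x_1]^m. *)
Fixpoint colsign (m : nat) (s : seq 'I_2) : K :=
  match m, s with
  | 0, [::] => 1
  | m'.+1, [:: x, y & s'] => ((x == ord0)%:R - (y == ord0)%:R) * colsign m' s'
  | _, _ => 0
  end.

Lemma colsign_size m s : colsign m s != 0 -> size s = (m + m)%N.
Proof.
elim: m s => [|m IH] [|x [|y s]] //=; rewrite ?eqxx // mulf_eq0 negb_or.
by case/andP=> _ /IH ->; rewrite addnS.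
Qed.

Lemma ord2_eq (x : 'I_2) : x = if x == ord0 then ord0 else ord_max.
Proof. by case: x => [[|[|k]] hk] //; apply: val_inj. Qed.

(** A nonzero factor forces the two letters of its pair to differ, so each pair contains each letter
    once. *)
Lemma colsign_count m s i : colsign m s != 0 -> count_mem i s = m.
Proof.
elim: m s => [|m IH] [|x [|y s]] //=; rewrite ?eqxx // mulf_eq0 negb_or.
case/andP=> xy /IH ->; rewrite addnA -[RHS]add1n; congr (_ + _)%N; move: xy.
rewrite [i]ord2_eq [x]ord2_eq [y]ord2_eq.
by case: (i == ord0); case: (x == ord0); case: (y == ord0); rewrite //= ?subrr ?eqxx.
Qed.

Lemma colsign_prod m s : size s = (m + m)%N ->
  colsign m s = \prod_(j < m) ((nth ord0 s (j + j)%N == ord0)%:R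
                             - (nth ord0 s (j + j).+1 == ord0)%:R).
Proof.
elim: m s => [|m IH] [|x [|y s]] //=; rewrite ?big_ord0 ?addnS //.
case=> sz; rewrite big_ord_recl IH //=; congr (_ * _).
by apply: eq_bigr => j _; rewrite /bump /= addnS.
Qed.

Variables (I : finType) (c : I -> 'I_2).
Local Notation Y i := (\sum_(j | c j == i) fvar K j).

Lemma mcoeff_sumvarM i (g : fralg K I) s :
  (Y i * g)@_(FMonom s) =
  if s is j :: t then (c j == i)%:R * g@_(FMonom t) else 0.
Proof.
rewrite mulr_suml raddf_sum /=.
rewrite (eq_bigr _ (fun j _ => mcoeff_varM j g s)).
case: s => [|j t]; first by rewrite big1.
have [ji|ji] := boolP (c j == i).
  rewrite (bigD1 j) //= eqxx mul1r big1 ?addr0 // => k /andP [_ kj].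
  by rewrite eq_sym (negPf kj) mul0r.
rewrite mul0r big1 // => k ki; case: eqP => [jk|_]; last by rewrite mul0r.
by rewrite jk ki in ji.
Qed.

Lemma mcoeff_comm_exp m s :
  (comm (Y ord0) (Y ord_max) ^+ m)@_(FMonom s) = colsign m (map c s).
Proof.
elim: m s => [|m IH] s.
  rewrite expr0 mcoeff1 -val_eqE /= fm1.
  by case: s.
rewrite exprS.
apply: etrans (mcoeff_commM _ _ (mcoeff_sumvarM ord0) (mcoeff_sumvarM ord_max)) _.
case: s => [|x [|y s]] //=; rewrite IH; congr (_ * _).
(* On two letters, [[x=0][y=1] - [x=1][y=0]] equals [[x=0] - [y=0]]. *)
rewrite [c x]ord2_eq [c y]ord2_eq.
by case: (c x == _); case: (c y == _); rewrite /= ?mulr1 ?mulr0 ?subr0 ?subrr ?sub0r.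
Qed.
End ColumnSign.

(** * Multilinear words as permutations, and the linearization in terms of them *)

Section Linearization.
Variables (K : fieldType) (n : nat).

(** The letter in position [k] is [s k], so renaming the variables is multiplication on the right
    and permuting the positions is multiplication on the left. *)
Definition perm_word (s : 'S_n) : {fmonom 'I_n} := FMonom [seq s k | k <- enum 'I_n].

Lemma perm_word_inj : injective perm_word.
Proof.
move=> s t [/eq_in_map e]; apply/permP => k; apply: e; exact: mem_enum.
Qed.

Lemma multilin_wordP (w : {fmonom 'I_n}) :
  reflect (exists s, w = perm_word s) (multilin_word w).
Proof.
rewrite /multilin_word -val_ord_tuple.
have E (p : 'S_n) : [tuple tnth (ord_tuple n) (p i) | i < n] = perm_word p :> seq _.
  by apply: eq_map => i; rewrite tnth_ord_tuple.
apply: (iffP tuple_permP) => -[p ep]; exists p; last by rewrite ep E.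
by apply: val_inj; rewrite /= ep E.
Qed.

Lemma multilin_perm_word s : multilin_word (perm_word s).
Proof. by apply/multilin_wordP; exists s. Qed.

Lemma mcoeff_multilin_part (f : fralg K 'I_n) w :
  (multilin_part f)@_w = if multilin_word w then f@_w else 0.
Proof.
rewrite /multilin_part big_mkcond raddf_sum /=.
have E k : (if multilin_word k then << f@_k *g k >> else 0)@_w =
    if multilin_word w then << f@_k *g k >>@_w else 0.
  case: (eqVneq k w) => [->|kw]; first by case: ifP => // _; rewrite mcoeff0.
  rewrite mcoeffU (negPf kw) mulr0n if_same.
  by case: ifP; rewrite ?mcoeff0 // mcoeffU (negPf kw).
rewrite (eq_bigr _ (fun k _ => E k)); case: ifP => _; last by rewrite big1.
by rewrite [in RHS](monalgE f) raddf_sum.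
Qed.

Lemma multilin_part0 : multilin_part (0 : fralg K 'I_n) = 0.
Proof. by apply/malgP => w; rewrite mcoeff_multilin_part mcoeff0 if_same. Qed.

Lemma prod_fvar (I J : choiceType) (v : I -> J) (s : seq I) :
  \prod_(i <- s) fvar K (v i) = << FMonom (map v s) >>.
Proof.
elim: s => [|i s IH]; first by rewrite big_nil -mpolyC1E -fmoneE.
rewrite big_cons IH /fvar malgM_def fgmulUU mulr1; congr << _ >>.
by apply: val_inj; rewrite /= fmM fmU.
Qed.

Lemma perm_vars_word (s t : 'S_n) :
  perm_vars s << perm_word t >> = << perm_word (t * s) >> :> fralg K 'I_n.
Proof.
rewrite /perm_vars /fsubst mmapU /= scale1r mul1r prod_fvar; congr << _ >>.
by apply: val_inj; rewrite /= -map_comp; apply: eq_map => k /=; rewrite permM.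
Qed.

Lemma fsubst_comm (I J : choiceType) (v : I -> fralg K J) (f g : fralg K I) :
  fsubst v (comm f g) = comm (fsubst v f) (fsubst v g).
Proof. exact: (@fsubst_lcomm K I J v f [:: g]). Qed.

Lemma fsubst_exp (I J : choiceType) (v : I -> fralg K J) (f : fralg K I) k :
  fsubst v (f ^+ k) = fsubst v f ^+ k.
Proof.
by elim: k => [|k IH]; rewrite ?expr0 ?fsubst1 // !exprS fsubstM IH.
Qed.

Variables (m : nat) (c : 'I_n -> 'I_2).
Let f : fralg K 'I_2 := comm (fvar K ord0) (fvar K ord_max) ^+ m.

Lemma linearization_comm_exp :
  linearization c f =
  \sum_(s : 'S_n) colsign K m (map c (perm_word s)) *: << perm_word s >>.
Proof.
rewrite [LHS](malg_expand perm_word_inj) => [|w]; last first.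
  rewrite mcoeff_multilin_part; case: ifP => [/multilin_wordP //|_].
  by rewrite eqxx.
apply: eq_bigr => s _; apply: (congr1 (fun a => a *: << perm_word s >>)).
rewrite mcoeff_multilin_part multilin_perm_word.
by rewrite fsubst_exp fsubst_comm !fsubst_var mcoeff_comm_exp.
Qed.

End Linearization.

(** * Closure properties of linear spans *)

Section LinearSpan.
Variables (K : fieldType) (V : lmodType K) (S : V -> Prop).

Lemma lspan0 : lspan S 0.
Proof. by exists [::]; rewrite big_nil. Qed.

Lemma lspan_gen x : S x -> lspan S x.
Proof.
move=> Sx; exists [:: (1, x)]; rewrite big_seq1 scale1r; split=> // t.
by rewrite inE => /eqP ->.
Qed.

Lemma lspanD x y : lspan S x -> lspan S y -> lspan S (x + y).
Proof.
move=> [s [hs ->]] [t [ht ->]]; exists (s ++ t); rewrite big_cat; split=> // u.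
by rewrite mem_cat => /orP [/hs|/ht].
Qed.

Lemma lspanZ a x : lspan S x -> lspan S (a *: x).
Proof.
move=> [s [hs ->]]; exists [seq (a * t.1, t.2) | t <- s]; split.
  by move=> u /mapP [t /hs St ->].
by rewrite big_map scaler_sumr; apply: eq_bigr => t _; rewrite scalerA.
Qed.

Lemma lspan_sum (I : Type) (r : seq I) (P : pred I) (F : I -> V) :
  (forall i, P i -> lspan S (F i)) -> lspan S (\sum_(i <- r | P i) F i).
Proof. by move=> SF; apply: big_ind => //; [exact: lspan0|exact: lspanD]. Qed.

Lemma lspan_ind (P : V -> Prop) :
  P 0 -> (forall x y, P x -> P y -> P (x + y)) ->
  (forall a x, S x -> P (a *: x)) -> forall x, lspan S x -> P x.
Proof.
move=> P0 PD PZ x [s [hs ->]]; rewrite big_seq; apply: big_ind => // t ts.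
by apply: PZ; apply: hs.
Qed.
End LinearSpan.

Lemma multilin_part_linear (K : fieldType) n a (f g : fralg K 'I_n) :
  multilin_part (a *: f + g) = a *: multilin_part f + multilin_part g.
Proof.
have E (u v : fralg K 'I_n) w : (a *: u + v)@_w = a * u@_w + v@_w.
  by rewrite mcoeffD mcoeffZ.
apply/malgP => w; apply: etrans (mcoeff_multilin_part _ _) _.
apply: esym; apply: etrans (E _ _ _) _.
apply: etrans (congr2 (fun x y => a * x + y) (mcoeff_multilin_part f w)
  (mcoeff_multilin_part g w)) _.
by case: ifP => _; [exact: esym (E _ _ _)|rewrite mulr0 addr0].
Qed.

(** * The linearization is proper and multilinear *)

Section ProperMultilinear.
Variables (K : fieldType) (n : nat).

Definition comm_prod (f : fralg K 'I_n) : Prop :=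
  exists ps : seq ('I_n * 'I_n), f = \prod_(t <- ps) comm (fvar K t.1) (fvar K t.2).

Lemma comm_prod_proper f : lspan comm_prod f -> Defs.proper f.
Proof.
apply: lspan_ind => [|x y|a x [ps ->]]; [exact: lspan0|exact: lspanD|].
apply: lspanZ; apply: lspan_gen; exists [seq (t.1, [:: t.2]) | t <- ps]; split.
  by move=> u /mapP [t _ ->].
by rewrite big_map; apply: eq_bigr.
Qed.

Lemma lspan_comm_prodM f g :
  lspan comm_prod f -> lspan comm_prod g -> lspan comm_prod (f * g).
Proof.
move=> Qf Qg; move: f Qf; apply: lspan_ind => [|x y Qx Qy|a x [ps ->]].
- by rewrite mul0r; apply: lspan0.
- by rewrite mulrDl; apply: lspanD.
rewrite -scalerAl; apply: lspanZ; move: g Qg.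
apply: lspan_ind => [|y z Qy Qz|b y [qs ->]].
- by rewrite mulr0; apply: lspan0.
- by rewrite mulrDr; apply: lspanD.
rewrite malgMZr; apply: lspanZ; apply: lspan_gen; exists (ps ++ qs).
by rewrite big_cat.
Qed.

Lemma comm_prod_perm_vars (s : 'S_n) f :
  lspan comm_prod f -> lspan comm_prod (perm_vars s f).
Proof.
rewrite /perm_vars; move: f; apply: lspan_ind => [|x y Qx Qy|a x [ps ->]].
- by rewrite fsubst0; apply: lspan0.
- by rewrite fsubstD; apply: lspanD.
rewrite fsubstZ; apply: lspanZ; apply: lspan_gen.
exists [seq (s t.1, s t.2) | t <- ps]; rewrite big_map.
rewrite (big_morph _ (fsubstM _) (fsubst1 _)); apply: eq_bigr => t _ /=.
by rewrite fsubst_comm !fsubst_var.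
Qed.

(** A product of commutators is multihomogeneous; hence taking the multilinear part either keeps it
    or kills it, and properness is preserved. *)
Lemma comm_prod_content (ps : seq ('I_n * 'I_n)) (w : {fmonom 'I_n}) :
  (\prod_(t <- ps) comm (fvar K t.1) (fvar K t.2))@_w != 0 ->
  perm_eq w (flatten [seq [:: t.1; t.2] | t <- ps]).
Proof.
rewrite -[w in _@_w]fmK.
elim: ps (w : seq _) => [|t ps IH] s.
  rewrite big_nil mcoeff1 -val_eqE /= fm1.
  by case: s => [|x s] /=; rewrite ?eqxx.
rewrite big_cons.
rewrite (mcoeff_commM _ _ (mcoeff_varM t.1) (mcoeff_varM t.2)).
case: s => [|x [|y s]]; rewrite ?eqxx //.
set a := mcoeff _ _; have [->|/IH sps] := eqVneq a 0.
  by rewrite mulr0 eqxx.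
have [/andP [/eqP -> /eqP ->] _|no1] := boolP ((x == t.1) && (y == t.2)).
  by rewrite !perm_cons.
have [/andP [/eqP -> /eqP ->] _|no2] := boolP ((x == t.2) && (y == t.1)).
  by rewrite -[[:: t.2, t.1 & s]]/([:: t.2] ++ [:: t.1] ++ s) perm_catCA !perm_cons.
by rewrite -!natrM !mulnb (negPf no1) (negPf no2) subrr mul0r eqxx.
Qed.

Lemma multilin_part_comm_prod f :
  lspan comm_prod f -> lspan comm_prod (multilin_part f).
Proof.
move: f; apply: lspan_ind => [|x y Qx Qy|a x [ps ->]].
- by rewrite multilin_part0; apply: lspan0.
- by rewrite -[x]scale1r multilin_part_linear scale1r; apply: lspanD.
set g := \prod_(t <- ps) _.
rewrite -[a *: g]addr0 multilin_part_linear multilin_part0 addr0; apply: lspanZ.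
have [Eps|Eps] := boolP (perm_eq (flatten [seq [:: t.1; t.2] | t <- ps]) (enum 'I_n)).
  suff -> : multilin_part g = g by apply: lspan_gen; exists ps.
  apply/malgP => w; rewrite mcoeff_multilin_part; case: ifP => // /negP Ew.
  have [->//|/comm_prod_content h] := eqVneq (g@_w) 0.
  by case: Ew; apply: perm_trans h Eps.
suff -> : multilin_part g = 0 by apply: lspan0.
apply/malgP => w; rewrite mcoeff_multilin_part mcoeff0; case: ifP => // Ew.
have [->//|/comm_prod_content h] := eqVneq (g@_w) 0.
by case/negP: Eps; rewrite perm_sym in h; apply: perm_trans h Ew.
Qed.

Lemma lspan_comm_prod_exp f k : lspan comm_prod f -> lspan comm_prod (f ^+ k).
Proof.
move=> Qf; elim: k => [|k IH].
  by rewrite expr0; apply: lspan_gen; exists [::]; rewrite big_nil.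
by rewrite exprS; apply: lspan_comm_prodM.
Qed.

(** By bilinearity the commutator of the two sums is a sum of commutators of variables. *)
Lemma linearization_comm_prod m (c : 'I_n -> 'I_2) :
  lspan comm_prod
    (linearization c (comm (fvar K ord0) (fvar K ord_max) ^+ m)).
Proof.
apply: multilin_part_comm_prod.
rewrite fsubst_exp fsubst_comm !fsubst_var; apply: lspan_comm_prod_exp.
have -> : comm (\sum_(j | c j == ord0) fvar K j) (\sum_(j | c j == ord_max) fvar K j) =
  \sum_(i | c i == ord0) \sum_(j | c j == ord_max) comm (fvar K i) (fvar K j).
  rewrite /comm mulr_suml [X in _ - X]mulr_sumr -sumrB; apply: eq_bigr => i _.
  by rewrite mulr_sumr mulr_suml -sumrB.
apply: lspan_sum => i _; apply: lspan_sum => j _; apply: lspan_gen.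
by exists [:: (i, j)]; rewrite big_seq1.
Qed.

Lemma multilinearP (f : fralg K 'I_n) :
  multilinear f <-> forall w, f@_w != 0 -> multilin_word w.
Proof. by split=> h w; move: (h w); rewrite mcoeff_neq0. Qed.

Lemma multilinear_lspan (f : fralg K 'I_n) :
  lspan (fun x => exists s, x = << perm_word s >>) f -> multilinear f.
Proof.
move=> Qf; apply/multilinearP; move: f Qf.
apply: lspan_ind => [w|x y hx hy w|a x [s ->] w].
- by rewrite mcoeff0 eqxx.
- rewrite mcoeffD; have [x0|/hx //] := eqVneq x@_w 0.
  by rewrite x0 add0r; apply: hy.
rewrite mcoeffZ mcoeffU1; have [<- _|_] := eqVneq (perm_word s) w.
  exact: multilin_perm_word.
by rewrite mulr0 eqxx.
Qed.

Lemma perm_vars_multilinear s f :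
  lspan (fun x : fralg K 'I_n => exists s, x = << perm_word s >>) f ->
  lspan (fun x : fralg K 'I_n => exists s, x = << perm_word s >>) (perm_vars s f).
Proof.
rewrite /perm_vars; move: f; apply: lspan_ind => [|x y Qx Qy|a x [t ->]].
- by rewrite fsubst0; apply: lspan0.
- by rewrite fsubstD; apply: lspanD.
rewrite fsubstZ -/(perm_vars _ _) perm_vars_word; apply: lspanZ; apply: lspan_gen.
by eexists.
Qed.
End ProperMultilinear.

Lemma count_enum_card n (T : eqType) (c : 'I_n -> T) i :
  count_mem i [seq c k | k <- enum 'I_n] = #|[set j | c j == i]|.
Proof.
rewrite -sum1_card -sum1_count big_map big_enum_cond /=.
by apply: eq_bigl => j; rewrite inE.
Qed.

(** Equal fibre sizes make the two tuples of values rearrangements of each other. *)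
Lemma fibre_perm n (T : eqType) (c r : 'I_n -> T) :
  (forall i, #|[set j | c j == i]| = #|[set j | r j == i]|) ->
  exists b : 'S_n, forall k, c (b k) = r k.
Proof.
move=> cr; have : perm_eq [tuple r k | k < n] [tuple c k | k < n].
  by apply/allP => i _; rewrite /= !count_enum_card cr.
case/tuple_permP => b eb; exists b => k.
have := congr1 (nth (r k) ^~ k) eb; rewrite -!tnth_nth.
by rewrite !tnth_mktuple.
Qed.

(** Aligns column [j] of the tableau with the factor [j] of the power of the commutator, which
    occupies the positions [2j] and [2j + 1] of a word. *)
Lemma interleave_perm n m (nE : n = (m + m)%N) : exists a : 'S_n,
  forall j, a (top nE j) = (j + j)%N :> nat /\ a (bot nE j) = (j + j).+1 :> nat.
Proof.
pose v (k : nat) := if (k < m)%N then (k + k)%N else (k - m + (k - m)).+1.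
have v_lt (k : 'I_n) : (v k < n)%N.
  by rewrite /v; have := ltn_ord k; case: ifP; lia.
have v_inj : injective (fun k : 'I_n => Ordinal (v_lt k)).
  move=> k l [] /= ekl; apply: val_inj => /=; move: ekl; rewrite /v.
  by case: ifP; case: ifP; lia.
exists (perm v_inj) => j; rewrite !permE /= /v /=.
by rewrite ltn_ord; split=> //; case: ifP; lia.
Qed.

(** * The linearization is not an identity *)

Section Nonvanishing.
Variables (K : fieldType) (n m : nat) (nE : n = (m + m)%N).
Hypothesis char0 : [pchar K] =i pred0.
Variable c : 'I_n -> 'I_2.
Hypothesis hc : forall i : 'I_2, #|[set j | c j == i]| = m.
Local Notation f := (comm (fvar K ord0) (fvar K ord_max) ^+ m : fralg K 'I_2).

(** The translation [a] aligns positions with columns, and [b] matches the given naming [c] of the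
    new variables with the rows of the tableau. Both sides then become the same product over
    columns. *)
Lemma colsign_coldet : exists a b : 'S_n, forall s : 'S_n,
  colsign K m (map c (perm_word s)) = coldet nE K (a * s * b)%g.
Proof.
have [a ha] := interleave_perm nE.
pose r (k : 'I_n) : 'I_2 := if upper m k then ord0 else ord_max.
have card_r i : #|[set j | r j == i]| = m.
  have -> : [set j | r j == i] =
    if i == ord0 then top nE @: 'I_m else bot nE @: 'I_m.
    rewrite [i]ord2_eq; apply/setP => k; rewrite inE /r.
    have [[j ->]|[j ->]] := ord_top_bot nE k; rewrite ?upper_top ?upper_bot;
      case: (i == ord0) => /=.
    + by rewrite eqxx (imset_f (top nE)) ?inE.
    + apply/esym/negP => /imsetP [l _ /eqP]; by rewrite top_bot_neq.
    + apply/esym/negP => /imsetP [l _ /eqP]; by rewrite eq_sym top_bot_neq.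
    + by rewrite eqxx (imset_f (bot nE)) ?inE.
  case: ifP => _; rewrite card_imset ?card_ord //.
  - exact: top_inj.
  - exact: bot_inj.
have [|b hb] := @fibre_perm n _ c r; first by move=> i; rewrite hc card_r.
have size_word (s : 'S_n) : size (perm_word s) = n.
  by rewrite size_map size_enum_ord.
(* Since [c] composed with [b] is the colouring [r] by rows, [c k] is the first letter exactly when
   [b^-1 k] lies in the upper row. *)
exists a, b^-1%g => s; rewrite colsign_prod; last by rewrite size_map size_word.
have cE k : (c k == ord0) = upper m (b^-1%g k).
  by rewrite -{1}[k](permKV b) hb /r; case: (upper _ _).
have nthE k (i : 'I_n) : i = k :> nat ->
    nth ord0 (map c (perm_word s)) k = c (s i).
  move=> <-; rewrite (nth_map i) ?size_word //.
  by rewrite (nth_map i) ?size_enum_ord // nth_ord_enum.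
rewrite /coldet; apply: eq_bigr => j _; have [ht hb'] := ha j.
by rewrite (nthE _ _ ht) (nthE _ _ hb') !cE !permM.
Qed.

Lemma eval_comm_exp (B : algType K) (z : 'I_2 -> B) :
  comm (z ord0) (z ord_max) ^+ m =
  \sum_(t : n.-tuple 'I_2) colsign K m t *: \prod_(x <- t) z x.
Proof.
have -> : comm (z ord0) (z ord_max) ^+ m = fsubst z f.
  by rewrite eval_exp eval_comm !eval_var.
have coefE s : f@_(FMonom s) = colsign K m s.
  (* Over the two-letter alphabet, with the identity for [c], each sum of variables is a single
     variable. *)
  by rewrite -{2}[s]map_id -mcoeff_comm_exp !big_pred1_eq.
rewrite [f](@malg_expand _ _ _ (fun t : n.-tuple 'I_2 => FMonom t)).
- rewrite eval_sum; apply: eq_bigr => t _; rewrite fsubstZ eval_word coefE.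
  by [].
- by move=> t u [] /val_inj.
move=> w; rewrite -[w]fmK coefE => /colsign_size; rewrite -nE => /eqP sz.
by exists (Tuple sz).
Qed.

(** Identifying variables along [c] sends several permutations to one word. Each word with nonzero
    coefficient arises equally often, [N] being the order of the stabilizer of [c]. *)
Lemma eval_linearization (B : algType K) (z : 'I_2 -> B) :
  exists2 N, (0 < N)%N &
  fsubst (z \o c) (linearization c f) = N%:R *: comm (z ord0) (z ord_max) ^+ m.
Proof.
pose stab := [set s : 'S_n | [forall k, c (s k) == c k]].
exists #|stab|.
  by apply/card_gt0P; exists 1%g; rewrite inE; apply/forallP => k; rewrite perm1.
pose h (s : 'S_n) := [tuple c (s k) | k < n].
have hE s : map c (perm_word s) = h s.
  by rewrite /= -map_comp.
pose G (t : seq 'I_2) : B := colsign K m t *: \prod_(x <- t) z x.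
rewrite linearization_comm_exp eval_sum.
rewrite (eq_bigr (fun s => G (h s))) => [|s _]; last first.
  by rewrite fsubstZ eval_word /G -hE big_map.
rewrite (partition_big h predT) // eval_comm_exp scaler_sumr.
apply: eq_bigr => t _; rewrite (eq_bigr (fun=> G t)) => [|s /andP [_ /eqP ->] //].
rewrite sumr_const -scaler_nat -/(G t).
have [G0|nz] := eqVneq (colsign K m t) 0.
  by rewrite /G G0 scale0r !scaler0.
(* Such a word [t] contains each letter [m] times, so it is [c] composed with some [s0]; the
   permutations yielding [t] form the coset [s0 * stab]. *)
have [|s0 hs0] := @fibre_perm n _ c (tnth t).
  move=> i; rewrite hc -(colsign_count i nz) -count_enum_card.
  by rewrite -[in LHS](map_tnth_enum t).
congr (_%:R *: _); rewrite -!sum1_card (reindex_inj (mulgI s0)).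
apply: eq_bigl => s; rewrite [RHS]inE -[LHS]/(h (s0 * s)%g == t).
apply/eqP/forallP => [e k|e].
  have := congr1 (fun u => tnth u (s0^-1%g k)) e; rewrite tnth_mktuple permM permKV -hs0.
  by rewrite permKV => ->.
by apply: eq_from_tnth => k; rewrite tnth_mktuple permM (eqP (e _)) hs0.
Qed.

Lemma linearization_notin_relI : linearization c f \notin relI K m.+1 n.
Proof.
apply/negP => Lrel.
have [B [F [a [b [hF ab]]]]] := exists_lie_nilpotent char0 m.
pose z (i : 'I_2) := if i == ord0 then a else b.
(* Extension of the evaluation by 0 to the variables beyond the first [n]. *)
pose zz (i : nat) : B := if insub i is Some j then z (c j) else 0.
have := @eval_relI _ B m.+1 n zz _ _ Lrel.
have -> : (fun i : 'I_n => zz i) = z \o c.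
  by apply: boolp.funext => i; rewrite /zz valK.
have [N N0 ->] := eval_linearization z.
move=> h; have /eqP := h (fun u us => @lie_filtration_lcomm K B m F u us hF).
by rewrite /z /= scaler_eq0 (negPf (natr_neq0 char0 N0)) (negPf ab).
Qed.
End Nonvanishing.

(** * From the regular module to the relatively free algebra *)

Section RelativelyFree.
Variables (K : fieldType) (p n : nat).
Local Notation G := [set: 'S_n]%G.
Local Notation aG := (regular_repr K G).
Local Notation R_G := (group_ring K G).

Fact to_relfree_linear : linear (@to_relfree K p n).
Proof.
move=> a f g.
apply: etrans (lquot_piD (relI_submod_closed K p n) _ _) _.
by congr (_ + _); apply: (lquot_piZ (relI_submod_closed K p n)).
Qed.

HB.instance Definition _ := GRing.isLinear.Build K (fralg K 'I_n)
  (relfree K p n) _ (@to_relfree K p n) to_relfree_linear.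

(** Identifies the regular module with the multilinear polynomials, the basis vector of [s] going to
    the word of [s]. *)
Definition multilin_poly (x : 'rV[K]_(gcard G)) : fralg K 'I_n :=
  \sum_i x 0 i *: << perm_word (enum_val i) >>.

Fact multilin_poly_linear : linear multilin_poly.
Proof.
move=> a x y; rewrite /multilin_poly scaler_sumr -big_split.
by apply: eq_bigr => i _; rewrite !mxE scalerDl scalerA.
Qed.

HB.instance Definition _ := GRing.isLinear.Build K 'rV[K]_(gcard G)
  (fralg K 'I_n) _ multilin_poly multilin_poly_linear.

Lemma multilin_poly_delta i :
  multilin_poly (delta_mx 0 i) = << perm_word (enum_val i) >>.
Proof.
rewrite /multilin_poly (bigD1 i) //= mxE !eqxx scale1r big1 ?addr0 // => j ji.
by rewrite mxE (negPf ji) scale0r.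
Qed.

Lemma multilin_poly_gring s : multilin_poly (gring_row (aG s)) = << perm_word s >>.
Proof. by rewrite gring_rowG ?inE // multilin_poly_delta gring_indexK ?inE. Qed.

Lemma multilin_polyJ x s :
  multilin_poly (x *m aG s) = perm_vars s (multilin_poly x).
Proof.
rewrite [x in LHS]row_sum_delta mulmx_suml linear_sum /perm_vars fsubst_sum.
apply: eq_bigr => i _; rewrite fsubstZ -/(perm_vars _ _) perm_vars_word.
by rewrite -scalemxAl linearZ /= -rowE rowK multilin_poly_delta gring_indexK ?inE.
Qed.

Definition relfree_of (x : 'rV[K]_(gcard G)) : relfree K p n :=
  to_relfree p (multilin_poly x).

HB.instance Definition _ := GRing.isLinear.Build K 'rV[K]_(gcard G)
  (relfree K p n) _ relfree_of (linearP (@to_relfree K p n \o multilin_poly)).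

Lemma relfree_ofJ x s : relfree_of (x *m aG s) = relfree_perm s (relfree_of x).
Proof. by rewrite /relfree_of relfree_permE multilin_polyJ. Qed.

Lemma Sn_span_relfree_of l w :
  Sn_span (relfree_of l) w <->
  exists2 A, (A \in R_G)%MS & w = relfree_of (l *m A).
Proof.
split.
  move: w; apply: lspan_ind => [|x y [A RA ->] [B RB ->]|a x [s ->]].
  - by exists 0; rewrite ?linear0 ?sub0mx // mulmx0 linear0.
  - by exists (A + B); rewrite ?linearD ?addmx_sub //= mulmxDr linearD.
  exists (a *: aG s); first by rewrite linearZ scalemx_sub //= envelop_mx_id ?inE.
  by rewrite -scalemxAr linearZ /= relfree_ofJ.
case=> A /envelop_mxP [a ->] ->; rewrite mulmx_sumr linear_sum.
apply: lspan_sum => s _; rewrite -scalemxAr linearZ /=; apply: lspanZ.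
by apply: lspan_gen; exists s; rewrite relfree_ofJ.
Qed.

Lemma Sn_span_relfree_ofZ e l w : e != 0 ->
  Sn_span (relfree_of (e *: l)) w <-> Sn_span (relfree_of l) w.
Proof.
have E c (x : 'rV[K]_(gcard G)) A : (c *: x) *m A = x *m (c *: A).
  by rewrite -scalemxAl -scalemxAr.
move=> nze; split=> /Sn_span_relfree_of [A RA ->]; apply/Sn_span_relfree_of.
  exists (e *: A); first by rewrite linearZ scalemx_sub.
  by congr (relfree_of _); apply: E.
exists (e^-1 *: A); first by rewrite linearZ scalemx_sub.
by congr (relfree_of _); rewrite E scalerA mulfV // scale1r.
Qed.
End RelativelyFree.

(** Both spans are stable under permutation of the variables, so every element of the generated
    module has a representative lying in both. *)
Lemma relGamma_Sn_span (K : fieldType) p n (f : fralg K 'I_n) w :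
  lspan (fun x : fralg K 'I_n => exists s, x = << perm_word s >>) f ->
  lspan (@comm_prod K n) f ->
  Sn_span (to_relfree p f) w -> relGamma w.
Proof.
move=> mf pf hw.
suff [g mg [pg ->]] : exists2 g, lspan (fun x : fralg K 'I_n =>
    exists s, x = << perm_word s >>) g & lspan (@comm_prod K n) g /\ w = to_relfree p g.
  by exists g => //; split; [exact: multilinear_lspan|exact: comm_prod_proper].
move: w hw; apply: lspan_ind => [|x y [g mg [pg ->]] [h mh [ph ->]]|a x [s ->]].
- by exists 0; [exact: lspan0|split; [exact: lspan0|rewrite linear0]].
- exists (g + h); first exact: lspanD.
  by split; [exact: lspanD|rewrite linearD].
exists (a *: perm_vars s f); first by apply: lspanZ; apply: perm_vars_multilinear.
split; first by apply: lspanZ; apply: comm_prod_perm_vars.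
by rewrite linearZ /= relfree_permE.
Qed.

Lemma affords_eq (K : fieldType) n (V : lmodType K) (act : 'S_n -> V -> V)
    (U W : V -> Prop) d (rG : mx_representation K [set: 'S_n] d) :
  (forall x, U x <-> W x) -> affords act U rG -> affords act W rG.
Proof.
move=> UW [b [hU hfree hact]]; exists b; split=> // x.
by rewrite -hU; split=> /UW.
Qed.

(** The case [p = m + 1], stated without subtraction. *)
Lemma two_row_module (K : fieldType) (m n : nat) (charK : [pchar K] =i pred0)
    (nE : n = (m + m)%N) (c : 'I_n -> 'I_2)
    (hc : forall i : 'I_2, #|[set j | c j == i]| = m) :
  let f : fralg K 'I_2 := comm (fvar K ord0) (fvar K ord_max) ^+ m in
  let v : relfree K m.+1 n := to_relfree m.+1 (linearization c f) in
  (forall w, Sn_span v w -> relGamma w) /\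
  exists (d : nat) (rG : mx_representation K [set: 'S_n] d),
    [/\ affords (@relfree_perm K m.+1 n) (Sn_span v) rG,
        mx_irreducible rG
      & mx_rsim rG (specht_repr K n [:: m; m])].
Proof.
move=> f v; split=> [w|].
  apply: relGamma_Sn_span; last exact: linearization_comm_prod.
  rewrite linearization_comm_exp; apply: lspan_sum => s _; apply: lspanZ.
  by apply: lspan_gen; exists s.
have [a [b hab]] := colsign_coldet K nE hc.
have [e he] := sum_coldet nE charK.
(* The word of [s] has coefficient [coldet (a s b)]; substituting [a^-1 s b^-1] for [s] turns the
   linearization into [a^-1 L b^-1] with [L = e QP] from [sum_coldet]. *)
pose A := regular_repr K [set: 'S_n]%G a^-1%g *m col_sum n m K *m
  row_sum n m K *m regular_repr K [set: 'S_n]%G b^-1%g.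
have [l lE] : exists l, l = gring_row A by eexists.
have vE : v = relfree_of m.+1 (e *: l).
  rewrite /v /relfree_of linearization_comm_exp; congr to_relfree.
  pose X := \sum_(s : 'S_n) coldet nE K (a * s * b)%g *: regular_repr K [set: 'S_n]%G s.
  have -> : e *: l = gring_row X.
    have -> : X = e *: A.
      have := congr1 (fun Y => regular_repr K [set: 'S_n]%G a^-1%g *m Y *m
        regular_repr K [set: 'S_n]%G b^-1%g) he.
      rewrite -scalemxAr -scalemxAl !mulmxA => <-.
      rewrite mulmx_sumr mulmx_suml (reindex_inj (mulgI a)) (reindex_inj (mulIg b)).
      rewrite /X; apply: eq_big => [s|s _]; first by rewrite !inE.
      rewrite -scalemxAr -scalemxAl -!regular_mxM !mulgA; congr (_ *: _).
      by rewrite mulVg mul1g -mulgA mulgV mulg1.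
    by rewrite lE linearZ.
  rewrite /X !linear_sum; apply: eq_bigr => s _.
  by rewrite !linearZ /= multilin_poly_gring hab.
have nzv : v != 0.
  apply/eqP => v0; have /negP := linearization_notin_relI nE charK hc; apply.
  rewrite -[linearization c f]subr0.
  apply/(lquot_piP (relI_submod_closed K m.+1 n)).
  by apply: etrans v0 (esym (linear0 (@to_relfree K m.+1 n))).
have nzl : relfree_of m.+1 l != 0.
  by apply: contraNneq nzv => l0; rewrite vE linearZ /= l0 scaler0.
(* The scalar [e] is not computed; that it is nonzero comes from [v] being nonzero, and then [v] and
   the image of [l] generate the same module. *)
have nze : e != 0.
  by apply: contraNneq nzv => e0; rewrite vE e0 scale0r linear0.
exists _, (specht_repr K n [:: m; m]); split.
- have := two_row_affords nE charK (@relfree_ofJ K m.+1 n) lE nzl.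
  apply: affords_eq => x.
  have := Sn_span_relfree_ofZ (p := m.+1) l x nze; rewrite -vE.
  have := Sn_span_relfree_of (p := m.+1) l x.
  by move=> h1 h2; apply: iff_trans (iff_sym h1) (iff_sym h2).
- apply/submod_mx_irr; apply: cyclic_young_simple => //.
  exact: (row_col_neq0 nE charK lE nzl).
- exact: mx_rsim_refl.
Qed.

Theorem proposition3p2 (K : fieldType) (p : nat)
    (charK : [pchar K] =i pred0) (hp : (2 <= p)%N)
    (c : 'I_(2 * p - 2) -> 'I_2)
    (hc : forall i : 'I_2, #|[set j | c j == i]| = (p - 1)%N) :
  let f : fralg K 'I_2 := comm (fvar K ord0) (fvar K ord_max) ^+ (p - 1) in
  let v : relfree K p (2 * p - 2) := to_relfree p (linearization c f) in
  (forall w, Sn_span v w -> relGamma w) /\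
  exists (d : nat) (rG : mx_representation K [set: 'S_(2 * p - 2)] d),
    [/\ affords (@relfree_perm K p (2 * p - 2)) (Sn_span v) rG,
        mx_irreducible rG
      & mx_rsim rG (specht_repr K (2 * p - 2) [:: (p - 1)%N; (p - 1)%N])].
Proof.
have nE : (2 * p - 2 = (p - 1) + (p - 1))%N by lia.
have pE : p = (p - 1).+1 by lia.
move=> f v; rewrite {}/v {}/f; move: (two_row_module charK nE hc).
by rewrite -pE.
Qed.
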